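(* Let $q\in\mathbb N$ (a positive integer) and $a\in\mathbb Z$, let $S\in SL(2,\mathbb Z)$, and set $M=S^{-1}AS$, where $A=\mathrm{diag}(d_1,d_2)$ with $d_1,d_2$ integers both having absolute value strictly greater than $1$. Write $D'=\mathcal F D_M\mathcal F^{-1}$. Then there exists a finitely generated projective $C(\mathbb T^2)$-submodule $V_0'$ of $\Xi$, isomorphic to $X(q,a)$, such that $V_1'=D'(V_0')\supseteq V_0'$, and more generally $V_i'=D'(V_{i-1}')\supseteq V_{i-1}'$ for all $i\in\mathbb N$, $i\ge 1$, with $$\overline{V_0'\cup\bigcup_{i\in\mathbb N}V_i'}=\Xi .$$ Furthermore, $$V_i'\cong X\big(|\det(M)|^i q,\ [\mathrm{sign}(\det(M))]^i a\big),$$ so that $$W_0=V_1'\ominus V_0'\cong X\big((|\det(M)|-1)q,\ (\mathrm{sign}(\det(M))-1)a\big).$$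
   Context: Write $e(r)=e^{2\pi i r}$. Functions in $C(\mathbb T^2)$ are identified with continuous $\mathbb Z^2$-periodic functions on $\mathbb R^2$. $\Xi$ is the right Hilbert $C(\mathbb T^2)$-module obtained by completing $C_c(\mathbb R^2)$ with respect to the norm $\|\xi\|=\|\langle\xi,\xi\rangle_{C(\mathbb T^2)}\|_\infty^{1/2}$ determined by $\langle \xi,\eta\rangle_{C(\mathbb T^2)}(t)=\sum_{p\in\mathbb Z^2}(\overline{\xi}\eta)(t-p)$, with $C(\mathbb T^2)$ acting by pointwise multiplication; its elements are continuous functions on $\mathbb R^2$ and $\Xi\subseteq L^2(\mathbb R^2)$. The closure is taken in the norm topology of $\Xi$, and $V_1'\ominus V_0'$ denotes the orthogonal complement of $V_0'$ in $V_1'$ with respect to the $C(\mathbb T^2)$-valued inner product. For $q\in\mathbb N$ and $a\in\mathbb Z$, $X(q,a)$ is the finitely generated projective right $C(\mathbb T^2)$-module of continuous $f:\mathbb R^2\to\mathbb C$, $1$-periodic in the first variable, satisfying $f(s,t-q)=e(as)f(s,t)$, with $C(\mathbb T^2)$ acting by pointwise multiplication. Isomorphisms are of $C(\mathbb T^2)$-modules. For an invertible matrix $M$, $D_M(\zeta)(x)=|\det M|^{1/2}\zeta(Mx)$ on $L^2(\mathbb R^2)$; $\mathcal F$ is the Fourier transform $\mathcal F(f)(x)=\int_{\mathbb R^2}f(t)e(-t\cdot x)\,dt$; explicitly $(\mathcal F D_M\mathcal F^{-1}\xi)(x)=|\det M|^{-1/2}\xi((M^t)^{-1}x)$. *)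

(* Defs.v *)
From HB Require Import structures.
From mathcomp Require Import all_boot all_order all_algebra.
From mathcomp Require Import complex.
From mathcomp Require Import all_classical all_reals all_analysis.
From mathcomp.analysis.showcase Require summability.

Set Implicit Arguments.
Unset Strict Implicit.
Unset Printing Implicit Defensive.
Import Order.TTheory GRing.Theory Num.Theory.
Import numFieldNormedType.Exports.

Local Open Scope classical_set_scope.
Local Open Scope ring_scope.
Local Open Scope complex_scope.

(* The alias carries no a priori module structure over the scalars [R[i]], so
   that below it can be made a module over C(T^2). The exponent [^o] selects
   the topology of [R[i]] given by its norm. *)
Definition fun2 (R : realType) : Type := 'cV[R]_2 -> R[i]^o.

HB.instance Definition _ (R : realType) :=
  GRing.ComNzRing.copy (fun2 R) ('cV[R]_2 -> R[i]^o).

Section Torus.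
Variable R : realType.
Implicit Types f g : fun2 R.

Definition intvec (p : 'cV[int]_2) : 'cV[R]_2 := map_mx intr p.

Definition torus_pred : {pred fun2 R} :=
  mem [set f : fun2 R | continuous f /\ forall p x, f (x - intvec p) = f x].

Record torus_fun := TorusFun {
  torus_val : fun2 R;
  _ : torus_val \in torus_pred }.

HB.instance Definition _ := [isSub for torus_val].
HB.instance Definition _ := [Choice of torus_fun by <:].

Fact torus_subring_closed : subring_closed torus_pred.
Proof.
split=> [|f g|f g].
- by rewrite inE; split=> [x|//]; exact: cst_continuous.
- rewrite !inE => -[cf pf] [cg pg]; split=> [x|p x].
    exact: (cvgB (cf x) (cg x)).
  exact: (congr2 (fun u v : R[i] => u - v) (pf p x) (pg p x)).
- rewrite !inE => -[cf pf] [cg pg]; split=> [x|p x].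
    exact: (cvgM (cf x) (cg x)).
  exact: (congr2 (fun u v : R[i] => u * v) (pf p x) (pg p x)).
Qed.
HB.instance Definition _ :=
  GRing.isSubringClosed.Build (fun2 R) torus_pred torus_subring_closed.
HB.instance Definition _ := [SubChoice_isSubComNzRing of torus_fun by <:].

Definition torus_scale (h : torus_fun) (f : fun2 R) : fun2 R :=
  fun x => torus_val h x * f x.

Fact torus_scaleA h k f :
  torus_scale h (torus_scale k f) = torus_scale (h * k) f.
Proof. by apply/funext => x; apply: mulrA. Qed.
Fact torus_scale1 : left_id 1 torus_scale.
Proof. by move=> f; apply/funext => x; apply: mul1r. Qed.
Fact torus_scaleDr : right_distributive torus_scale +%R.
Proof. by move=> h f g; apply/funext => x; apply: mulrDr. Qed.
Fact torus_scaleDl f : {morph torus_scale^~ f : h k / h + k}.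
Proof. by move=> h k; apply/funext => x; apply: mulrDl. Qed.
HB.instance Definition _ := GRing.Zmodule_isLmodule.Build torus_fun (fun2 R)
  torus_scaleA torus_scale1 torus_scaleDr torus_scaleDl.

End Torus.

Section Modules.
Variable R : realType.
Implicit Types (E : lmodType (torus_fun R)).

(* C(T^2) is commutative, so its right modules are written as left ones. *)
Definition submodule E (V : set E) : Prop := submod_closed (mem V).

Definition module_hom E E' (V : set E) (V' : set E') (phi : E -> E') : Prop :=
  [/\ set_fun V V' phi,
      {in V &, {morph phi : u v / u + v}} &
      forall h : torus_fun R, {in V, {morph phi : v / h *: v}}].

Definition module_iso E E' (V : set E) (V' : set E') : Prop :=
  [/\ submodule V, submodule V' &
      exists2 phi, module_hom V V' phi & set_bij V V' phi].

Definition fg_projective E (V : set E) : Prop :=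
  exists n (P Q : set 'rV[torus_fun R]_n),
    [/\ submodule P, submodule Q,
        (forall u, exists v w, [/\ P v, Q w & u = v + w]),
        P `&` Q = [set 0] & module_iso V P].

End Modules.

Section Xi.
Variable R : realType.
Implicit Types (xi eta : fun2 R) (U V : set (fun2 R)).

Definition Cc : set (fun2 R) :=
  [set xi : fun2 R | continuous xi /\ compact (closure [set x | xi x != 0])].

(* The series is summed along the net of finite subsets of Z^2; it converges
   absolutely for [xi] and [eta] in [Xi]. *)
Definition inner xi eta : fun2 R := fun t =>
  summability.sum (fun p : 'cV[int]_2 =>
    (xi (t - intvec R p))^* * eta (t - intvec R p) : R[i]^o).

(* sup_t <xi, xi>(t)^(1/2), an extended real so that it makes sense for
   every function and is [+oo] when the series of nonnegative terms diverges. *)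
Definition Xi_norm xi : \bar R :=
  ereal_sup [set sqrte (\esum_(p in [set: 'cV[int]_2])
    (Normc.normc (xi (t - intvec R p)) ^+ 2)%:E) | t in [set: 'cV[R]_2]].

Definition Xi_closure U : set (fun2 R) :=
  [set xi | forall eps : R, 0 < eps ->
     exists2 eta, U eta & (Xi_norm (xi - eta)%R < eps%:E)%E].

(* The functions with finite [Xi_norm] are the bounded maps from a fundamental
   domain to l^2(Z^2), and form a Banach space; the completion of [Cc] is hence
   its closure among functions. Its elements are automatically continuous, as
   [Xi_norm] dominates the uniform norm. *)
Definition Xi : set (fun2 R) := Xi_closure Cc.

Definition orth_compl V U : set (fun2 R) :=
  [set xi | V xi /\ forall eta, U eta -> inner eta xi = 0].

Definition e (r : R) : R[i] := cos (2 * pi * r) +i* sin (2 * pi * r).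

Definition pt (s t : R) : 'cV[R]_2 := \col_i (if i == 0 then s else t).

Definition X (q : nat) (a : int) : set (fun2 R) :=
  [set f : fun2 R | [/\ continuous f,
    forall s t, f (pt (s + 1) t) = f (pt s t) &
    forall s t, f (pt s (t - q%:R)) = e (a%:~R * s) * f (pt s t)]].

(* F D_M F^-1 for the Fourier transform F and the unitary dilation
   D_M zeta (x) = |det M|^(1/2) zeta (M x); conjugating by F replaces M with
   the inverse of its transpose. *)
Definition Dprime (M : 'M[R]_2) xi : fun2 R := fun x =>
  ((Num.sqrt `|\det M|)^-1)%:C * xi (invmx M^T *m x).

Definition ladder (M : 'M[R]_2) V0 (i : nat) : set (fun2 R) :=
  iter i (fun V => Dprime M @` V) V0.

End Xi.

(* Main.v *)
(* The fibre of Xi over t is l^2(t + Z^2). In coordinates which diagonalize M^T,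
   V_0 consists of the products f sigma, where f runs through the sections of a
   line bundle of degree a on R^2 / (Z x qZ) and sigma(s, t) = phi(s) phi(t / q)
   is a bump of Meyer type: the translates of sigma^2 under Z x qZ add up to 1,
   and the dilation by A^-1 maps the support of sigma into the set where sigma
   is 1. The latter gives V_0 <= V_1, and the union of the V_i is C_c(R^2).

   Each V_i is thus the module of sections of a line bundle on a torus covering
   T^2. Cutting a circle of length k1 + k2 into circles of lengths k1 and k2,
   with a rotation on the overlap, splits such a module into two, so that rank
   and degree are additive and determine the module; a quadratic phase shows
   that SL(2, Z) does not affect this classification. If the twist of the bundle
   is concentrated near s = 0, then the inclusion of V_0 in V_1 is itself the
   composite of a cut along s and a cut along t, and the orthogonal complement
   is the sum of the two parts cut off. *)
Require Import Defs.
From mathcomp Require Import all_boot all_order all_algebra.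
From mathcomp Require Import complex finmap ring lra zify.
From mathcomp Require Import all_classical all_reals all_analysis.

Set Implicit Arguments.
Unset Strict Implicit.
Unset Printing Implicit Defensive.
Import Order.TTheory GRing.Theory Num.Theory.
Import numFieldNormedType.Exports.

Local Open Scope classical_set_scope.
Local Open Scope ring_scope.
Local Open Scope complex_scope.

(** * Continuity, phases and bump functions *)

(** The twists of [V_0] and [V_1] differ: their degrees are [a] and [sgz (\det M) * a]. The
    inclusion survives this because [V_1] contains every continuous function supported on the
    plateau of its bump, whatever its twist is. The complement is where the twist matters. Pairing
    [h sigma'] in [V_1] with [f sigma] in [V_0] adds the values of [h] at [s] and [s - 1] with the
    weights [phi (s)] and [phi (s - 1)], which are the cosine and sine of one angle: this is the
    first row of the matrix of a cut. But a cut along [s] is compatible with the relation in [t]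
    only if the multipliers of the pieces agree with that of the whole wherever the respective
    weight is nonzero, and a multiplier such as [e (b s / k)] violates this in general. Hence the
    degree is concentrated within distance 1/3 of the multiples of the period of [V_1]. The piece of
    width 1 then receives all of it and the rest is untwisted; the cut along [t] gives the degree
    [a] back to [V_0] and leaves [(sgz (\det M) - 1) * a]. *)

Section Continuity.
Variable R : realType.

Lemma continuous_cplx (T : topologicalType) (a b : T -> R) :
  continuous a -> continuous b ->
  continuous (fun x => a x +i* b x : R[i]^o).
Proof.
move=> ca cb x; apply/cvgrPdist_lt => eps eps0.
(* In the order of [R[i]], [0 < eps] forces [eps] to be real. *)
have [d deps] : exists d : R, eps = d%:C.
  by exists (complex.Re eps); rewrite RRe_real // realE ltW.
move: eps0; rewrite {}deps ltcR => d0.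
have d20 : 0 < d / 2 by rewrite divr_gt0.
have /cvgrPdist_lt/(_ _ d20) Ha := ca x.
have /cvgrPdist_lt/(_ _ d20) Hb := cb x.
near=> y.
have ha : `|a x - a y| < d / 2 by near: y.
have hb : `|b x - b y| < d / 2 by near: y.
rewrite normc_def /= ltcR.
have -> : d = Num.sqrt (d ^+ 2) by rewrite sqrtr_sqr gtr0_norm.
rewrite ltr_sqrt ?exprn_gt0 // -[in X in X < _]real_normK ?num_real //.
rewrite -[X in _ + X < _]real_normK ?num_real //.
have := normr_ge0 (a x - a y); have := normr_ge0 (b x - b y).
by nra.
Unshelve. all: by end_near. Qed.

Lemma continuous_real_complex (T : topologicalType) (a : T -> R) :
  continuous a -> continuous (fun x => (a x)%:C : R[i]^o).
Proof.
move=> ca; apply: (@continuous_cplx _ a (fun=> 0)) => // x; exact: cvg_cst.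
Qed.

Lemma continuous_e (T : topologicalType) (a : T -> R) :
  continuous a -> continuous (fun x => e (a x) : R[i]^o).
Proof.
move=> ca; have c2 : continuous (fun x => 2 * pi * a x).
  by move=> x; apply: cvgM; [exact: cvg_cst|exact: ca].
apply: continuous_cplx => x.
  by apply: (continuous_comp (c2 x)); exact: continuous_cos.
by apply: (continuous_comp (c2 x)); exact: continuous_sin.
Qed.

Lemma continuous_pt (T : topologicalType) (a b : T -> R) :
  continuous a -> continuous b -> continuous (fun y => pt (a y) (b y)).
Proof.
move=> ca cb x; apply/cvg_ballP => d d0.
have /cvg_ballP/(_ _ d0) Ha := ca x.
have /cvg_ballP/(_ _ d0) Hb := cb x.
near=> y; split=> // i j; rewrite !mxE.
by case: ifP => _; near: y.
Unshelve. all: by end_near. Qed.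

(** Away from the integers the floor is locally constant, and near an integer value of [rho] only
    two strips meet, so agreement on the seams suffices. Quasi-periodic extensions are glued in this
    way. *)
Lemma continuous_strips (T Y : topologicalType) (rho : T -> R)
    (F : int -> T -> Y) :
  continuous rho -> (forall n, continuous (F n)) ->
  (forall n x, rho x = (n + 1)%:~R -> F n x = F (n + 1) x) ->
  continuous (fun x => F (Num.floor (rho x)) x).
Proof.
move=> crho cF eqF x U /= HU.
set n := Num.floor (rho x) in HU.
have /andP[le1 lt1] := real_floor_itv (num_real (rho x)).
rewrite -/n in le1 lt1.
have upx : \forall y \near x, rho y < (n + 1)%:~R.
  by have := lt_nbhsl lt1 => /(crho x).
have Fn : \forall y \near x, U (F n y) by exact: cF.
have [eqx|neqx] := eqVneq (rho x) n%:~R; last first.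
  have lox : \forall y \near x, n%:~R < rho y.
    have : n%:~R < rho x by rewrite lt_neqAle eq_sym neqx.
    by move=> /lt_nbhsr /(crho x).
  suff : \forall y \near x, U (F (Num.floor (rho y)) y) by [].
  near=> y.
  have -> : Num.floor (rho y) = n.
    by apply/floor_def/andP; split; [apply: ltW|]; near: y.
  by near: y.
(* On the seam [rho x = n] the strip below enters too; its formula has the same value at [x]. *)
have Fn1 : \forall y \near x, U (F (n - 1) y).
  by apply: cF; rewrite eqF ?subrK.
have lox : \forall y \near x, (n - 1)%:~R < rho y.
  have : (n - 1)%:~R < rho x by rewrite eqx ltr_int; lia.
  by move=> /lt_nbhsr /(crho x).
suff : \forall y \near x, U (F (Num.floor (rho y)) y) by [].
near=> y.
have [ny|ny] := lerP n%:~R (rho y).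
  have -> : Num.floor (rho y) = n.
    by apply/floor_def/andP; split => //; near: y.
  by near: y.
have -> : Num.floor (rho y) = n - 1.
  apply/floor_def/andP; split; last by rewrite subrK.
  by apply: ltW; near: y.
by near: y.
Unshelve. all: by end_near. Qed.

Lemma continuous_glue (T Y : topologicalType) (rho : T -> R) (c : R)
    (F G : T -> Y) :
  continuous rho -> continuous F -> continuous G ->
  (forall x, rho x = c -> F x = G x) ->
  continuous (fun x => if rho x <= c then F x else G x).
Proof.
move=> crho cF cG eqFG x U /= HU.
suff : \forall y \near x, U (if rho y <= c then F y else G y) by [].
case: (ltrgtP (rho x) c) HU => [lt|lt|eqx] HU.
- have H : \forall y \near x, rho y < c by have := lt_nbhsl lt => /(crho x).
  near=> y; rewrite ifT; last by apply: ltW; near: y.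
  by near: y; exact: cF.
- have H : \forall y \near x, c < rho y by have := lt_nbhsr lt => /(crho x).
  near=> y; rewrite leNgt ifF; last by apply/negbTE/negPn; near: y.
  by near: y; exact: cG.
- near=> y; case: ifP => _; near: y; first exact: cF.
  by apply: cG; rewrite -eqFG.
Unshelve. all: by end_near. Qed.

End Continuity.

Section Phase.
Variable R : realType.
Implicit Types x y : R.

Lemma eD x y : e (x + y) = e x * e y.
Proof.
rewrite /e mulrDr cosD sinD; apply/eqP; rewrite eq_complex /=.
by apply/andP; split; apply/eqP; ring.
Qed.

Lemma e0 : e (0 : R) = 1.
Proof. by rewrite /e mulr0 cos0 sin0. Qed.

Lemma e_conj x : Num.conj (e x) = e (- x).
Proof. by rewrite /e mulrN cosN sinN. Qed.

Lemma e1 : e (1 : R) = 1.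
Proof. by rewrite /e mulr1 mulr_natl cos2pi sin2pi. Qed.

Lemma eN1 : e (-1 : R) = 1.
Proof. by rewrite -[LHS]mul1r -[X in X * _]e1 -eD subrr e0. Qed.

Lemma e_half : e (2^-1 : R) = -1.
Proof.
rewrite /e mulrAC divff ?mul1r ?pnatr_eq0 // cospi sinpi.
by apply/eqP; rewrite eq_complex /= oppr0 !eqxx.
Qed.

Lemma e_nat (n : nat) : e (n%:R : R) = 1.
Proof. by elim: n => [|n IHn]; rewrite ?e0 // -addn1 natrD eD IHn e1 mulr1. Qed.

Lemma e_conjM x : (e x)^* * e x = 1.
Proof. by rewrite e_conj -eD addNr e0. Qed.

Lemma e_int (n : int) : e (n%:~R : R) = 1.
Proof.
case: n => n; first exact: e_nat.
by have := e_conjM n.+1%:R; rewrite e_conj !e_nat mulr1 NegzE mulrNz.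
Qed.

Lemma e_neq0 x : e x != 0.
Proof.
apply/eqP => ex; have := e_conjM x; rewrite ex mulr0 => /eqP.
by rewrite eq_sym oner_eq0.
Qed.

Lemma eV x : (e x)^-1 = e (- x).
Proof. by apply: (mulIf (e_neq0 x)); rewrite mulVf ?e_neq0 // -eD addNr e0. Qed.

Lemma eB_int x y (n : int) : x = y + n%:~R -> e x = e y.
Proof. by move=> ->; rewrite eD e_int mulr1. Qed.

End Phase.

Section Bumps.
Variable R : realType.
Implicit Types s m : R.

Definition clamp s : R := Num.min 1 (Num.max 0 s).

Lemma clamp_le0 s : s <= 0 -> clamp s = 0.
Proof. by move=> s0; rewrite /clamp max_l // min_r. Qed.

Lemma clamp_ge1 s : 1 <= s -> clamp s = 1.
Proof.
by move=> s1; rewrite /clamp max_r ?min_l // (le_trans _ s1).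
Qed.

Lemma clampE s : 0 <= s <= 1 -> clamp s = s.
Proof. by move=> /andP[s0 s1]; rewrite /clamp max_r // min_r. Qed.

Lemma clampC s : clamp (1 - s) = 1 - clamp s.
Proof.
have [s0|s0] := lerP s 0; first by rewrite (clamp_le0 s0) clamp_ge1; lra.
have [s1|s1] := lerP 1 s; first by rewrite (clamp_ge1 s1) clamp_le0; lra.
by rewrite !clampE; lra.
Qed.

Lemma clamp_itv s : 0 <= clamp s <= 1.
Proof.
have [s0|s0] := lerP s 0; first by rewrite clamp_le0 // lexx ler01.
have [s1|s1] := lerP 1 s; first by rewrite (clamp_ge1 s1) lexx ler01.
by rewrite !clampE; lra.
Qed.

Lemma continuous_clamp (T : topologicalType) (a : T -> R) :
  continuous a -> continuous (fun x => clamp (a x)).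
Proof.
move=> ca x.
apply: (@continuous_min _ _ (fun=> 1) (fun x => Num.max 0 (a x))).
  exact: cvg_cst.
apply: (@continuous_max _ _ (fun=> 0) a); [exact: cvg_cst|exact: ca].
Qed.

(** Cosine and sine of one angle, which rises from 0 at [|s| = 1/3] to [pi / 2] at [|s| = 2/3]: the
    pair is a row of an orthogonal matrix, and [phi] alone is the window function. *)
Definition phi s : R := cos (pi / 2 * clamp (3 * `|s| - 1)).
Definition psi s : R := sin (pi / 2 * clamp (3 * `|s| - 1)).

Let continuous_angle (T : topologicalType) (a : T -> R) :
  continuous a -> continuous (fun x => pi / 2 * clamp (3 * `|a x| - 1)).
Proof.
move=> ca x; apply: cvgM; first exact: cvg_cst.
apply: (continuous_clamp (a := fun x => 3 * `|a x| - 1)) => y.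
apply: cvgB; last exact: cvg_cst.
by apply: cvgM; [exact: cvg_cst|apply: cvg_norm; exact: ca].
Qed.

Lemma continuous_phi (T : topologicalType) (a : T -> R) :
  continuous a -> continuous (fun x => phi (a x)).
Proof.
move=> /continuous_angle ca x; apply: (continuous_comp (ca x)).
exact: continuous_cos.
Qed.

Lemma continuous_psi (T : topologicalType) (a : T -> R) :
  continuous a -> continuous (fun x => psi (a x)).
Proof.
move=> /continuous_angle ca x; apply: (continuous_comp (ca x)).
exact: continuous_sin.
Qed.

Lemma phi_norm s : phi `|s| = phi s.
Proof. by rewrite /phi normr_id. Qed.

Lemma phi_eq1 s : `|s| <= 3^-1 -> phi s = 1.
Proof. by move=> hs; rewrite /phi clamp_le0 ?mulr0 ?cos0 //; lra. Qed.

Lemma psi_eq0 s : `|s| <= 3^-1 -> psi s = 0.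
Proof. by move=> hs; rewrite /psi clamp_le0 ?mulr0 ?sin0 //; lra. Qed.

Lemma phi_eq0 s : 2 / 3 <= `|s| -> phi s = 0.
Proof. by move=> hs; rewrite /phi clamp_ge1 ?mulr1 ?cos_pihalf //; lra. Qed.

Lemma psi_eq1 s : 2 / 3 <= `|s| -> psi s = 1.
Proof. by move=> hs; rewrite /psi clamp_ge1 ?mulr1 ?sin_pihalf //; lra. Qed.

Lemma phi2Dpsi2 s : phi s ^+ 2 + psi s ^+ 2 = 1.
Proof. exact: cos2Dsin2. Qed.

Lemma phi_neq0 s : `|s| <= 2^-1 -> phi s != 0.
Proof.
move=> hs; apply: lt0r_neq0; apply: cos_gt0_pihalf.
have p0 := pi_gt0 R.
have /andP[c0 _] := clamp_itv (3 * `|s| - 1).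
have c1 : clamp (3 * `|s| - 1) <= 2^-1.
  have [?|?] := lerP (3 * `|s| - 1) 0; first by rewrite clamp_le0 ?invr_ge0.
  by rewrite clampE; lra.
by apply/andP; split; nra.
Qed.

(** The angles at [s] and [1 - s] add up to [pi / 2], by [clampC]. *)
Lemma psiE s : 0 <= s <= 1 -> psi s = phi (s - 1).
Proof.
move=> /andP[s0 s1]; rewrite /psi /phi (ger0_norm s0).
rewrite -[s - 1]opprB normrN ger0_norm ?subr_ge0 //.
have -> : 3 * (1 - s) - 1 = 1 - (3 * s - 1) by ring.
by rewrite clampC mulrBr mulr1 cosB cos_pihalf sin_pihalf mul0r add0r mul1r.
Qed.

(* A lift of a circle map of degree one that is constant outside the
   [1 / (3 m)]-neighbourhood of the integers. *)
Definition Theta m s : R :=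
  let n : R := (Num.floor (s + 2^-1))%:~R in
  n + clamp (3 * m * (s - n) / 2 + 2^-1).

Lemma ThetaE m s (n : int) : 1 <= m -> `|s - n%:~R| <= 2^-1 ->
  Theta m s = n%:~R + clamp (3 * m * (s - n%:~R) / 2 + 2^-1).
Proof.
move=> m1; rewrite ler_norml => /andP[h1 h2].
have [eqs|neqs] := eqVneq (s - n%:~R) 2^-1; last first.
  have fl : Num.floor (s + 2^-1) = n.
    apply/floor_def; rewrite intrD; move: neqs; rewrite neq_lt => /orP[]; lra.
  by rewrite /Theta fl.
have fl : Num.floor (s + 2^-1) = n + 1.
  by apply/floor_def; rewrite !intrD; lra.
have sE : s = n%:~R + 2^-1 by rewrite -eqs; ring.
rewrite /Theta fl intrD sE clamp_le0; last by nra.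
by rewrite clamp_ge1 ?addr0 //; nra.
Qed.

Lemma near_int s : exists n : int, `|s - n%:~R| <= 2^-1.
Proof.
exists (Num.floor (s + 2^-1)).
have := real_floor_itv (num_real (s + 2^-1)); rewrite intrD => /andP[? ?].
by rewrite ler_norml; lra.
Qed.

Lemma ThetaB1 m s : 1 <= m -> Theta m (s - 1) = Theta m s - 1.
Proof.
move=> m1; have [n hn] := near_int s.
rewrite (ThetaE m1 hn) (@ThetaE _ _ (n - 1)) // intrB; last first.
  by rewrite (_ : _ - _ = s - n%:~R) //; ring.
rewrite (_ : s - 1 - _ = s - n%:~R); [ring|by ring].
Qed.

Lemma ThetaN m s : 1 <= m -> Theta m (- s) = 1 - Theta m s.
Proof.
move=> m1; have [n hn] := near_int s.
rewrite (ThetaE m1 hn) (@ThetaE _ _ (- n)) // mulrNz; last first.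
  by rewrite -opprD normrN.
rewrite (_ : 3 * m * _ / 2 + _ = 1 - (3 * m * (s - n%:~R) / 2 + 2^-1)).
  by rewrite clampC; ring.
by rewrite -opprD -[s + _]/(s - _); field.
Qed.

Lemma Theta_const m s : 1 <= m -> 3^-1 <= m * s -> m * s <= m - 3^-1 ->
  Theta m s = 1.
Proof.
move=> m1 h1 h2; have [s2|s2] := lerP s 2^-1.
  rewrite (@ThetaE _ _ 0) // subr0; last by rewrite ler_norml; nra.
  by rewrite clamp_ge1 ?add0r //; nra.
rewrite (@ThetaE _ _ 1) //; last by rewrite ler_norml; nra.
by rewrite clamp_le0 ?addr0 //; nra.
Qed.

(** Measured in [m * s] the jump at 0 has the same shape for every [m], and the jumps of [Theta 1]
    at the adjacent integers begin only at distance 2/3 from 0. This is also the radius of the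
    support of [phi]. *)
Lemma Theta_rescale m s : 1 <= m -> 2 <= m -> `|m * s| <= 2 / 3 ->
  Theta m s = Theta 1 (m * s).
Proof.
move=> m1 m2; rewrite ler_norml => /andP[h1 h2].
rewrite (@ThetaE m _ 0) // ?subr0; last by rewrite ler_norml; nra.
have [s2|s2] := lerP `|m * s| 2^-1.
  by rewrite (@ThetaE 1 _ 0) ?subr0 // mulr1 mulrA.
have [s0|s0] := lerP 0 (m * s).
  rewrite ger0_norm // in s2.
  rewrite (@ThetaE 1 _ 1) //; last by rewrite ler_norml; nra.
  by rewrite (@clamp_ge1 (_ + _)) ?clamp_le0 ?addr0 ?add0r //; nra.
rewrite ltr0_norm // in s2.
rewrite (@ThetaE 1 _ (-1)) //; last by rewrite ler_norml; lra.
rewrite (_ : (-1)%:~R = -1 :> R) // (@clamp_le0 (_ + _)); last by nra.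
by rewrite clamp_ge1 ?addr0 ?addNr //; nra.
Qed.

Lemma continuous_Theta m (T : topologicalType) (a : T -> R) :
  1 <= m -> continuous a -> continuous (fun x => Theta m (a x)).
Proof.
move=> m1 ca.
apply: (@continuous_strips _ _ _ (fun x => a x + 2^-1)
  (fun n x => n%:~R + clamp (3 * m * (a x - n%:~R) / 2 + 2^-1))).
- by move=> x; apply: cvgD; [exact: ca|exact: cvg_cst].
- move=> n x; apply: cvgD; first exact: cvg_cst.
  apply: (continuous_clamp (a := fun x => 3 * m * (a x - n%:~R) / 2 + 2^-1)).
  move=> y; apply: cvgD; last exact: cvg_cst.
  apply: cvgM; last exact: cvg_cst.
  apply: cvgM; first exact: cvg_cst.
  by apply: cvgB; [exact: ca|exact: cvg_cst].
move=> n x ax; rewrite intrD in ax; have {}ax : a x = n%:~R + 2^-1 by lra.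
rewrite ax clamp_ge1; last by nra.
by rewrite clamp_le0 ?addr0 ?intrD //; nra.
Qed.

End Bumps.

(** * Modules over C(T^2) *)

Section ModuleIso.
Variable R : realType.
Local Notation C := (torus_fun R).

Lemma submoduleP (E : lmodType C) (V : set E) :
  submodule V <->
  V 0 /\ forall (a : C) u v, V u -> V v -> V (a *: u + v).
Proof.
rewrite /submodule; split=> [[V0 VD]|[V0 VD]].
  split=> [|a u v Vu Vv]; first by have := V0; rewrite inE.
  by have := VD a u v; rewrite !inE; apply.
split=> [|a u v]; first by rewrite inE.
by rewrite !inE; exact: VD.
Qed.

Lemma submoduleZ (E : lmodType C) (V : set E) (a : C) u :
  submodule V -> V u -> V (a *: u).
Proof.
by move=> /submoduleP[V0 VD] Vu; rewrite -[_ *: _]addr0; exact: VD.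
Qed.

Lemma module_isoP (E E' : lmodType C) (V : set E) (V' : set E') :
  module_iso V V' <->
  [/\ submodule V, submodule V' &
   exists f g,
   [/\ forall u, V u -> V' (f u), forall v, V' v -> V (g v),
       forall u, V u -> g (f u) = u, forall v, V' v -> f (g v) = v &
       forall a u v, V u -> V v -> f (a *: u + v) = a *: f u + f v]].
Proof.
split=> [[sV sV' [f [fV fD fZ] [_ f_inj f_surj]]]|[sV sV' [f [g]]]].
  (* The inverse is chosen pointwise, with the default value 0 off [V']. *)
  split => //; have /choice[g Hg] : forall v, exists u,
      V' v -> V u /\ f u = v.
    move=> v; have [V'v|nV'v] := pselect (V' v); last by exists 0.
    by have [u Vu <-] := f_surj _ V'v; exists u.
  exists f, g; split=> //.
  - by move=> v /Hg[].
  - move=> u Vu; have [Vg fg] := Hg _ (fV _ Vu).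
    by apply: f_inj; rewrite ?inE.
  - by move=> v /Hg[].
  - move=> a u v Vu Vv; rewrite fD ?inE // ?fZ ?inE //.
    exact: submoduleZ.
move=> [fV gV gK fK lf]; split=> //; exists f; split.
- exact: fV.
- move=> u v; rewrite !inE => Vu Vv.
  by have := lf 1 u v Vu Vv; rewrite !scale1r.
- move=> a u; rewrite inE => Vu.
  have V0 : V 0 by have /submoduleP[] := sV.
  have f0 : f 0 = 0.
    have := lf 1 0 0 V0 V0; rewrite !scale1r addr0 => /(congr1 (+%R^~ (- f 0))).
    by rewrite addrK subrr => /esym.
  by have := lf a u 0 Vu V0; rewrite f0 !addr0.
- exact: fV.
- move=> u v; rewrite !inE => Vu Vv fuv.
  by rewrite -(gK _ Vu) -(gK _ Vv) fuv.
- by move=> v V'v; exists (g v); [exact: gV|exact: fK].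
Qed.

Lemma module_iso_lker (E E' : lmodType C) (V : set E) (V' : set E')
    (f : E -> E') :
  submodule V -> submodule V' ->
  (forall u, V u -> V' (f u)) ->
  (forall a u v, V u -> V v -> f (a *: u + v) = a *: f u + f v) ->
  (forall u, V u -> f u = 0 -> u = 0) ->
  (forall v, V' v -> exists2 u, V u & f u = v) ->
  module_iso V V'.
Proof.
move=> sV sV' fV lf f_inj f_surj; apply/module_isoP; split=> //.
have [V0 VD] := (submoduleP V).1 sV.
have /choice[g Hg] : forall v, exists u, V' v -> V u /\ f u = v.
  move=> v; have [V'v|nV'v] := pselect (V' v); last by exists 0.
  by have [u Vu <-] := f_surj _ V'v; exists u.
exists f, g; split=> //.
- by move=> v /Hg[].
- move=> u Vu; have [Vg fg] := Hg _ (fV _ Vu).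
  apply/eqP; rewrite -subr_eq0; apply/eqP/f_inj.
    by rewrite addrC -scaleN1r; apply: VD.
  rewrite addrC -scaleN1r lf // fg scaleN1r addNr //.
- by move=> v /Hg[].
Qed.

Lemma module_iso_refl (E : lmodType C) (V : set E) :
  submodule V -> module_iso V V.
Proof. by move=> sV; apply/module_isoP; split=> //; exists id, id. Qed.

Lemma module_iso_sym (E E' : lmodType C) (V : set E) (V' : set E') :
  module_iso V V' -> module_iso V' V.
Proof.
move=> /module_isoP[sV sV' [f [g [fV gV gK fK lf]]]].
apply/module_isoP; split=> //; exists g, f; split=> // a u v V'u V'v.
have [V0 VD] := (submoduleP V).1 sV.
rewrite -[in LHS](fK _ V'u) -[in LHS](fK _ V'v) -lf ?gK //; try exact: gV.
by apply: VD; exact: gV.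
Qed.

Lemma module_iso_trans (E E' E'' : lmodType C) (V : set E) (V' : set E')
    (V'' : set E'') :
  module_iso V V' -> module_iso V' V'' -> module_iso V V''.
Proof.
move=> /module_isoP[sV sV' [f [g [fV gV gK fK lf]]]].
move=> /module_isoP[_ sV'' [f' [g' [fV' gV' gK' fK' lf']]]].
apply/module_isoP; split=> //; exists (f' \o f), (g \o g'); split=> /=.
- by move=> u Vu; exact/fV'/fV.
- by move=> v V'v; exact/gV/gV'.
- by move=> u Vu; rewrite gK' ?gK //; exact: fV.
- by move=> v V'v; rewrite fK ?fK' //; exact: gV'.
- by move=> a u v Vu Vv; rewrite lf // lf' //; exact: fV.
Qed.

Lemma submodule_prod (E E' : lmodType C) (V : set E) (V' : set E') :
  submodule V -> submodule V' -> submodule (V `*` V').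
Proof.
move=> /submoduleP[V0 VD] /submoduleP[V'0 VD'].
apply/submoduleP; split=> [//|a u v [Vu1 Vu2] [Vv1 Vv2]].
by split; [exact: VD|exact: VD'].
Qed.

Lemma module_iso_prod (E E' F F' : lmodType C) (V : set E) (V' : set E')
    (W : set F) (W' : set F') :
  module_iso V V' -> module_iso W W' -> module_iso (V `*` W) (V' `*` W').
Proof.
move=> /module_isoP[sV sV' [f [g [fV gV gK fK lf]]]].
move=> /module_isoP[sW sW' [h [k [hW kW kK hK lh]]]].
apply/module_isoP; split; [exact: submodule_prod|exact: submodule_prod|].
exists (fun x => (f x.1, h x.2)), (fun x => (g x.1, k x.2)); split.
- by move=> u [Vu Wu]; split; [exact: fV|exact: hW].
- by move=> u [Vu Wu]; split; [exact: gV|exact: kW].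
- by move=> [u v] [/= Vu Wu]; rewrite gK ?kK.
- by move=> [u v] [/= Vu Wu]; rewrite fK ?hK.
- by move=> a [u1 u2] [v1 v2] [/= Vu Wu] [/= Vv Wv]; rewrite lf ?lh.
Qed.

Lemma module_iso_prodC (E E' : lmodType C) (V : set E) (V' : set E') :
  submodule V -> submodule V' -> module_iso (V `*` V') (V' `*` V).
Proof.
move=> sV sV'; apply/module_isoP; split; try exact: submodule_prod.
exists (fun x => (x.2, x.1)), (fun x => (x.2, x.1)).
by split=> // [u []|u []|[u v]|[u v]].
Qed.

(** A linear change of variables is not linear over C(T^2): it twists the scalars by an automorphism
    [tau]. Conjugating an isomorphism by two maps with the same twist restores linearity. *)
Lemma module_iso_semilinear (E E' : lmodType C) (V : set E) (V' : set E')
    (tau tau' : C -> C) (r r' : E -> E) (q q' : E' -> E') :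
  cancel tau' tau -> cancel r r' -> cancel r' r -> cancel q q' -> cancel q' q ->
  (forall a u v, r (a *: u + v) = tau a *: r u + r v) ->
  (forall a u v, q (a *: u + v) = tau a *: q u + q v) ->
  module_iso V V' -> module_iso (r @` V) (q @` V').
Proof.
have sub (F : lmodType C) (W : set F) (p : F -> F) : cancel tau' tau ->
    (forall a u v, p (a *: u + v) = tau a *: p u + p v) ->
    submodule W -> submodule (p @` W).
  move=> tK lp /submoduleP[W0 WD]; apply/submoduleP; split.
    exists 0 => //; have := lp (tau' 1) 0 0; rewrite tK scaler0 addr0 scale1r.
    by move=> /(congr1 (+%R^~ (- p 0))); rewrite addrK subrr => /esym.
  move=> a _ _ [u Wu <-] [v Wv <-]; exists (tau' a *: u + v); first exact: WD.
  by rewrite lp tK.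
move=> tK rK rK' qK qK' lr lq /module_isoP[sV sV' [f [g [fV gV gK fK lf]]]].
apply/module_isoP; split; try exact: sub.
exists (fun u => q (f (r' u))), (fun v => r (g (q' v))); split.
- by move=> _ [u Vu <-]; rewrite rK; exists (f u) => //; exact: fV.
- by move=> _ [u Vu <-]; rewrite qK; exists (g u) => //; exact: gV.
- by move=> _ [u Vu <-]; rewrite qK rK gK.
- by move=> _ [u Vu <-]; rewrite qK rK fK.
- move=> a _ _ [u Vu <-] [v Vv <-]; rewrite -{1}(tK a) -lr !rK lf // lq.
  by rewrite tK.
Qed.

End ModuleIso.

(** * Quasi-periodic functions *)

Section Plane.
Variable R : realType.
Implicit Types (f g : fun2 R) (h : torus_fun R) (s t : R).

Lemma pt0 s t : pt s t 0 0 = s.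
Proof. by rewrite mxE. Qed.

Lemma pt1 s t : pt s t 1 0 = t.
Proof. by rewrite mxE. Qed.

Lemma pt_eta (x : 'cV[R]_2) : x = pt (x 0 0) (x 1 0).
Proof.
apply/colP => i; rewrite mxE.
by case: i => [[|[|//]] hi]; rewrite /=; congr (x _ _); exact: val_inj.
Qed.

Lemma pt_eq (x : 'cV[R]_2) s t : x 0 0 = s -> x 1 0 = t -> x = pt s t.
Proof. by move=> <- <-; exact: pt_eta. Qed.

Lemma fun2P f g : (forall s t, f (pt s t) = g (pt s t)) -> f = g.
Proof. by move=> fg; apply/funext => x; rewrite (pt_eta x). Qed.

Lemma ptB_intvec s t (p : 'cV[int]_2) :
  pt s t - intvec R p = pt (s - (p 0 0)%:~R) (t - (p 1 0)%:~R).
Proof. by apply: pt_eq; rewrite !mxE. Qed.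

Lemma continuous_coord i : continuous (fun x : 'cV[R]_2 => x i 0).
Proof. exact: coord_continuous. Qed.

Lemma continuous_comp_coord (w : R -> R[i]^o) (i : 'I_2) :
  continuous w -> continuous (fun x : 'cV[R]_2 => w (x i 0)).
Proof.
move=> cw x; apply: (@continuous_comp _ _ _ (fun x : 'cV[R]_2 => x i 0) w).
  exact: continuous_coord.
exact: cw.
Qed.

Lemma continuous_fun2 (T : topologicalType) f (a b : T -> R) :
  continuous f -> continuous a -> continuous b ->
  continuous (fun x => f (pt (a x) (b x))).
Proof.
move=> cf ca cb x.
apply: (@continuous_comp _ _ R[i]^o (fun x => pt (a x) (b x)) f).
  exact: continuous_pt.
exact: cf.
Qed.

Lemma torus_valB h s t (m n : int) :
  torus_val h (pt (s - m%:~R) (t - n%:~R)) = torus_val h (pt s t).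
Proof.
have := valP h; rewrite inE => -[_ hper].
have := hper (\col_i (if i == 0 then m else n)) (pt s t).
by rewrite ptB_intvec !mxE.
Qed.

Lemma torus_valBs h s t (m : int) :
  torus_val h (pt (s - m%:~R) t) = torus_val h (pt s t).
Proof. by have := torus_valB h s t m 0; rewrite subr0. Qed.

Lemma torus_valBt h s t (m : int) :
  torus_val h (pt s (t - m%:~R)) = torus_val h (pt s t).
Proof. by have := torus_valB h s t 0 m; rewrite subr0. Qed.

Lemma continuous_torus h : continuous (torus_val h).
Proof. by have := valP h; rewrite inE => -[]. Qed.

Lemma fun2DE f g x : (f + g) x = f x + g x. Proof. by []. Qed.

Lemma fun2ZE h f x : (h *: f) x = torus_val h x * f x. Proof. by []. Qed.

Lemma continuous_cst (T Y : topologicalType) (y : Y) :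
  continuous (fun _ : T => y).
Proof. exact: cst_continuous. Qed.

Lemma continuousDr (T : topologicalType) (a b : T -> R) :
  continuous a -> continuous b -> continuous (fun x => a x + b x).
Proof. by move=> ca cb x; apply: cvgD; [exact: ca|exact: cb]. Qed.

Lemma continuousBr (T : topologicalType) (a b : T -> R) :
  continuous a -> continuous b -> continuous (fun x => a x - b x).
Proof. by move=> ca cb x; apply: cvgB; [exact: ca|exact: cb]. Qed.

Lemma continuousMr (T : topologicalType) (a b : T -> R) :
  continuous a -> continuous b -> continuous (fun x => a x * b x).
Proof. by move=> ca cb x; apply: cvgM; [exact: ca|exact: cb]. Qed.

Lemma continuousD2 (T : topologicalType) (f g : T -> R[i]^o) :
  continuous f -> continuous g -> continuous (fun x => f x + g x : R[i]^o).
Proof. by move=> cf cg x; apply: cvgD; [exact: cf|exact: cg]. Qed.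

Lemma continuousB2 (T : topologicalType) (f g : T -> R[i]^o) :
  continuous f -> continuous g -> continuous (fun x => f x - g x : R[i]^o).
Proof. by move=> cf cg x; apply: cvgB; [exact: cf|exact: cg]. Qed.

Lemma continuousM2 (T : topologicalType) (f g : T -> R[i]^o) :
  continuous f -> continuous g -> continuous (fun x => f x * g x : R[i]^o).
Proof. by move=> cf cg x; apply: cvgM; [exact: cf|exact: cg]. Qed.

Lemma continuousV2 (T : topologicalType) (f : T -> R[i]^o) :
  continuous f -> (forall x, f x != 0) ->
  continuous (fun x => (f x)^-1 : R[i]^o).
Proof. by move=> cf f0 x; apply: cvgV; [exact: f0|exact: cf]. Qed.

Lemma continuous_exprz (T : topologicalType) (f : T -> R[i]^o) (n : int) :
  continuous f -> (forall x, f x != 0) ->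
  continuous (fun x => (f x) ^ n : R[i]^o).
Proof.
move=> cf f0; have pos (m : nat) : continuous (fun x => (f x) ^+ m : R[i]^o).
  elim: m => [x|m IHm]; first exact: cvg_cst.
  by under eq_fun do rewrite exprS; exact: continuousM2.
have fX m x : f x ^+ m != 0 by rewrite expf_neq0.
case: n => m; [exact: pos|exact: (continuousV2 (pos m.+1) (fX m.+1))].
Qed.

End Plane.

Section QuasiPeriodic.
Variable R : realType.
Implicit Types (f g F G : fun2 R) (h : torus_fun R) (s t : R) (w u : R -> R[i]).
Implicit Types k l : nat.

(* The sections of a line bundle on the torus of periods [k] and [l], given by
   its multipliers [w] and [u]; [X q a] is [Z 1 1 q (e (a s))]. *)
Definition Z k w l u : set (fun2 R) :=
  [set f : fun2 R | [/\ continuous f,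
    forall s t, f (pt (s - k%:R) t) = w t * f (pt s t) &
    forall s t, f (pt s (t - l%:R)) = u s * f (pt s t)]].

Definition multiplier l w :=
  [/\ continuous (w : R -> R[i]^o), forall t, w t != 0 &
      forall t, w (t - l%:R) = w t].

Lemma submodule_Z k w l u : submodule (Z k w l u).
Proof.
apply/submoduleP; split.
  by split=> [x|s t|s t]; [exact: cst_continuous|rewrite mulr0|rewrite mulr0].
move=> h f g [cf fs ft] [cg gs gt]; split.
- exact: (continuousD2 (continuousM2 (@continuous_torus _ h) cf) cg).
- move=> s t; rewrite !fun2DE !fun2ZE fs gs -[k%:R]/(k%:~R) torus_valBs.
  by rewrite mulrDr mulrCA.
- move=> s t; rewrite !fun2DE !fun2ZE ft gt -[l%:R]/(l%:~R) torus_valBt.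
  by rewrite mulrDr mulrCA.
Qed.

Lemma quasi_shift (P : R -> R[i]) (c : R) (z : R[i]) : z != 0 ->
  (forall s, P (s - c) = z * P s) ->
  forall (n : int) s, P (s - n%:~R * c) = z ^ n * P s.
Proof.
move=> z0 Pc n s.
have pos (m : nat) s' : P (s' - m%:R * c) = z ^+ m * P s'.
  elim: m => [|m IHm]; first by rewrite mul0r subr0 mul1r.
  rewrite exprS -mulrA -IHm -Pc; congr P.
  by rewrite -addn1 natrD; ring.
case: n => n; first exact: pos.
have := pos n.+1 (s - (Negz n)%:~R * c).
rewrite (_ : _ - _ = s); last by rewrite NegzE mulrNz; ring.
by move=> ->; rewrite /= mulKf // expf_neq0.
Qed.

Lemma Z_shift k w l u f : (forall t, w t != 0) -> Z k w l u f ->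
  forall (n : int) s t, f (pt (s - n%:~R * k%:R) t) = w t ^ n * f (pt s t).
Proof.
move=> w0 [_ fs _] n s t.
exact: (@quasi_shift (fun s => f (pt s t)) k%:R (w t)).
Qed.

Lemma periodic_shift w l : (forall t, w (t - l%:R) = w t) ->
  forall (n : int) t, w (t - n%:~R * l%:R) = w t.
Proof.
move=> wl n t; rewrite (@quasi_shift w l%:R 1) ?oner_neq0 //.
  by rewrite exp1rz mul1r.
by move=> s; rewrite mul1r.
Qed.

(** A nowhere vanishing [G] changes the multipliers by its coboundary. *)
Lemma Z_gauge k w w' l u u' (G : fun2 R) :
  continuous G -> (forall x, G x != 0) ->
  (forall s t, G (pt (s - k%:R) t) * w t = w' t * G (pt s t)) ->
  (forall s t, G (pt s (t - l%:R)) * u s = u' s * G (pt s t)) ->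
  module_iso (Z k w l u) (Z k w' l u').
Proof.
move=> cG G0 Gs Gt; apply/module_isoP; split; try exact: submodule_Z.
exists (fun f x => G x * f x), (fun f x => (G x)^-1 * f x); split.
- move=> f [cf fs ft]; split=> [|s t|s t]; first exact: (continuousM2 cG cf).
    by rewrite fs !mulrA Gs.
  by rewrite ft !mulrA Gt.
- move=> f [cf fs ft]; split=> [|s t|s t].
  + exact: (continuousM2 (continuousV2 cG G0) cf).
  + apply: (mulfI (G0 (pt (s - k%:R) t))); rewrite mulVKf // fs.
    by rewrite !mulrA Gs -!mulrA mulVKf.
  + apply: (mulfI (G0 (pt s (t - l%:R)))); rewrite mulVKf // ft.
    by rewrite !mulrA Gt -!mulrA mulVKf.
- by move=> f _; apply/funext => x; rewrite mulKf.
- by move=> f _; apply/funext => x; rewrite mulVKf.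
- move=> h f g _ _; apply/funext => x.
  by rewrite !fun2DE !fun2ZE mulrDr mulrCA.
Qed.

Section Extension.
Variables (a : R) (k : nat) (w : R -> R[i]).
Hypothesis k_gt0 : (0 < k)%N.

Let k0 : 0 < k%:R :> R. Proof. by rewrite ltr0n. Qed.

(* The extension of the restriction of [F] to the strip [a <= s < a + k]
   satisfying [f (s - k) = w f (s)]. *)
Definition ext (F : fun2 R) : fun2 R := fun x =>
  let n := Num.floor ((x 0 0 - a) / k%:R) in
  w (x 1 0) ^ (- n) * F (pt (x 0 0 - n%:~R * k%:R) (x 1 0)).

Lemma window s : exists (n : int) s', a <= s' < a + k%:R /\
  s = s' - n%:~R * k%:R.
Proof.
have := real_floor_itv (num_real ((s - a) / k%:R)).
set n := Num.floor _; rewrite intrD => /andP[h1 h2].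
exists (- n), (s - n%:~R * k%:R); split; last by rewrite mulrNz; ring.
rewrite ler_pdivlMr // in h1; rewrite ltr_pdivrMr // in h2.
by lra.
Qed.

Lemma ext_window F s t : a <= s < a + k%:R -> ext F (pt s t) = F (pt s t).
Proof.
move=> /andP[h1 h2]; rewrite /ext !pt0 !pt1.
have -> : Num.floor ((s - a) / k%:R) = 0.
  by apply/floor_def; rewrite ler_pdivlMr // ltr_pdivrMr //; lra.
by rewrite oppr0 expr0z mul1r mul0r subr0.
Qed.

Lemma ext_linear h F G : ext (h *: F + G) = h *: ext F + ext G.
Proof.
apply: fun2P => s t; rewrite !fun2DE !fun2ZE /ext !pt0 !pt1 !fun2DE !fun2ZE.
rewrite mulrDr mulrCA -[k%:R]/(k%:~R) -intrM torus_valBs //.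
Qed.

Lemma ext_shift F s t : w t != 0 ->
  ext F (pt (s - k%:R) t) = w t * ext F (pt s t).
Proof.
move=> w0; rewrite /ext !pt0 !pt1.
have -> : (s - k%:R - a) / k%:R = (s - a) / k%:R - 1.
  by field; exact: lt0r_neq0.
have -> y : Num.floor (y - 1 : R) = Num.floor y - 1.
  apply/floor_def; have := real_floor_itv (num_real y).
  by rewrite subrK intrD intrB => /andP[? ?]; apply/andP; split; lra.
set n := Num.floor _; rewrite mulrA; congr (_ * F (pt _ _)).
  by rewrite opprD opprK addrC exprzDr // expr1z.
by rewrite intrD; ring.
Qed.

Lemma continuous_ext F l : multiplier l w -> continuous F ->
  (forall t, F (pt a t) = w t * F (pt (a + k%:R) t)) -> continuous (ext F).
Proof.
move=> [cw w0 _] cF Fa.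
apply: (@continuous_strips R _ _ (fun x : 'cV[R]_2 => (x 0 0 - a) / k%:R)
  (fun n x => w (x 1 0) ^ (- n) * F (pt (x 0 0 - n%:~R * k%:R) (x 1 0))
    : R[i]^o)).
- apply: continuousMr; last exact: continuous_cst.
  by apply: continuousBr; [exact: continuous_coord|exact: continuous_cst].
- move=> n; apply: continuousM2.
    by apply: continuous_exprz => [|x]; [exact: continuous_comp_coord|].
  apply: (continuous_fun2 cF); last exact: continuous_coord.
  by apply: continuousBr; [exact: continuous_coord|exact: continuous_cst].
- move=> n x /(canRL (divfK (lt0r_neq0 k0))); rewrite intrD => hx.
  have -> : x 0 0 - n%:~R * k%:R = a + k%:R by move: hx; lra.
  rewrite (_ : _ - _ = a); last by move: hx; lra.
  rewrite Fa opprD exprzDr ?unitfE // (_ : w _ ^ (-1) = (w (x 1 0))^-1) //.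
  by rewrite mulrA divfK.
Qed.

(** The relations in the two directions are compatible because [u] has period [k] and [w] has period
    [l]; hence the second need only be checked in the window, and the gluing only at its edges. *)
Lemma Z_ext F l u : multiplier l w -> continuous F ->
  (forall s, u (s - k%:R) = u s) ->
  (forall t, F (pt a t) = w t * F (pt (a + k%:R) t)) ->
  (forall s t, a <= s < a + k%:R ->
     F (pt s (t - l%:R)) = u s * F (pt s t)) ->
  Z k w l u (ext F).
Proof.
move=> mw cF uk Fa Ft; split; first exact: (continuous_ext mw).
  by move=> s t; have [_ w0 _] := mw; exact: ext_shift.
have [_ w0 wl] := mw.
have extn (n : int) s t : ext F (pt (s - n%:~R * k%:R) t) =
    w t ^ n * ext F (pt s t).
  apply: (@quasi_shift (fun s => ext F (pt s t))) => // s'.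
  exact: ext_shift.
move=> s t; have [n [s' [hs' ->]]] := window s.
rewrite !extn !ext_window // Ft // wl (periodic_shift uk).
by rewrite mulrCA.
Qed.

Lemma Z_eq f g l u : (forall t, w t != 0) -> Z k w l u f -> Z k w l u g ->
  (forall s t, a <= s < a + k%:R -> f (pt s t) = g (pt s t)) -> f = g.
Proof.
move=> w0 Zf Zg fg; apply: fun2P => s t; have [n [s' [hs' ->]]] := window s.
by rewrite (Z_shift w0 Zf) (Z_shift w0 Zg) fg.
Qed.

End Extension.

End QuasiPeriodic.

(** * Cutting a torus into two *)

Section Pull.
Variable R : realType.
Implicit Types (f g : fun2 R) (h : torus_fun R) (V : set (fun2 R)).
Implicit Types J : 'M[int]_2.

Definition pull J f : fun2 R := fun x => f (map_mx intr J *m x).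

Lemma mulmx_pt (M : 'M[R]_2) (x : 'cV[R]_2) :
  M *m x = pt (M 0 0 * x 0 0 + M 0 1 * x 1 0) (M 1 0 * x 0 0 + M 1 1 * x 1 0).
Proof.
by apply: pt_eq; rewrite mxE !big_ord_recl big_ord0 addr0;
  congr (_ * _ + M _ _ * x _ _); exact: val_inj.
Qed.

Lemma continuous_mulmx (f : fun2 R) (M : 'M[R]_2) :
  continuous f -> continuous (fun x => f (M *m x) : R[i]^o).
Proof.
move=> cf; under eq_fun do rewrite mulmx_pt.
have lin (a b : R) : continuous (fun x : 'cV[R]_2 => a * x 0 0 + b * x 1 0).
  by apply: continuousDr; apply: continuousMr;
    (exact: continuous_cst || exact: continuous_coord).
by apply: (continuous_fun2 cf); exact: lin.
Qed.

Lemma continuous_pull J f : continuous f -> continuous (pull J f).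
Proof. exact: continuous_mulmx. Qed.

Lemma torus_pull J h : pull J (torus_val h) \in @torus_pred R.
Proof.
rewrite inE; split; first exact/continuous_pull/continuous_torus.
move=> p x; have := valP h; rewrite inE => -[_ hper].
rewrite /pull mulmxBr -[RHS](hper (J *m p)); congr (torus_val h (_ - _)).
by rewrite /intvec map_mxM.
Qed.

Definition tpull J h : torus_fun R := TorusFun (torus_pull J h).

Lemma pullM J J' f : pull J (pull J' f) = pull (J' *m J) f.
Proof. by apply/funext => x; rewrite /pull map_mxM mulmxA. Qed.

Lemma pull1 f : pull 1%:M f = f.
Proof. by apply/funext => x; rewrite /pull map_mx1 mul1mx. Qed.

Lemma pullK J J' : J' *m J = 1%:M -> cancel (pull J') (pull J).
Proof. by move=> JJ' f; rewrite pullM JJ' pull1. Qed.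

Lemma tpullK J J' : J' *m J = 1%:M -> cancel (tpull J') (tpull J).
Proof. by move=> JJ' h; apply: val_inj; rewrite /= (pullK JJ'). Qed.

Lemma pull_linear J h f g :
  pull J (h *: f + g) = tpull J h *: pull J f + pull J g.
Proof. by []. Qed.

Lemma module_iso_pull J J' V V' : J *m J' = 1%:M -> J' *m J = 1%:M ->
  module_iso V V' -> module_iso (pull J @` V) (pull J @` V').
Proof.
move=> JJ' J'J; apply: (module_iso_semilinear (tpullK J'J) (pullK JJ')
  (pullK J'J) (pullK JJ') (pullK J'J) (@pull_linear J) (@pull_linear J)).
Qed.

Lemma module_iso_pull_prod J J' V V1 V2 : J *m J' = 1%:M -> J' *m J = 1%:M ->
  module_iso V (V1 `*` V2) ->
  module_iso (pull J @` V) ((pull J @` V1) `*` (pull J @` V2)).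
Proof.
move=> JJ' J'J iV.
pose q I (x : fun2 R * fun2 R) := (pull I x.1, pull I x.2).
have -> : (pull J @` V1) `*` (pull J @` V2) = q J @` (V1 `*` V2).
  apply/seteqP; split.
    by move=> [_ _] [/= [u Vu <-] [v Vv <-]]; exists (u, v).
  by move=> _ [[u v] [/= Vu Vv] <-]; split; [exists u|exists v].
have qK I I' : I' *m I = 1%:M -> cancel (q I') (q I).
  by move=> II' [u v]; rewrite /q /= !(pullK II').
apply: (module_iso_semilinear (tpullK J'J) (pullK JJ')
  (pullK J'J) (qK _ _ JJ') (qK _ _ J'J) (@pull_linear J) _ iV).
by move=> a [u1 u2] [v1 v2].
Qed.

Definition swap : 'M[int]_2 := \matrix_(i, j) (i != j)%:R.

Lemma swapK : swap *m swap = 1%:M.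
Proof.
apply/matrixP => i j; rewrite !mxE !big_ord_recl big_ord0 !mxE.
by case: i j => [[|[|//]] hi] [[|[|//]] hj].
Qed.

Lemma pull_swap f s t : pull swap f (pt s t) = f (pt t s).
Proof.
rewrite /pull mulmx_pt !pt0 !pt1 !mxE /=.
by rewrite !mul0r !mul1r add0r addr0.
Qed.

Lemma pull_swap_Z k (w : R -> R[i]) l (u : R -> R[i]) :
  pull swap @` Z k w l u = Z l u k w.
Proof.
apply/seteqP; split=> [_ [f [cf fs ft] <-]|f [cf fs ft]].
  split; first exact: continuous_pull.
    by move=> s t; rewrite !pull_swap.
  by move=> s t; rewrite !pull_swap.
exists (pull swap f); last exact: (pullK swapK).
split; first exact: continuous_pull.
  by move=> s t; rewrite !pull_swap.
by move=> s t; rewrite !pull_swap.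
Qed.

End Pull.

(* A circle of length [k1 + k2] is turned into circles of lengths [k1] and [k2]
   by rotating the pair of values at [s] and [s - k1] by the unitary matrix
   [[c, d], [d, - c]] while [s] runs through [0, k1]. The determinant [-1] of
   this matrix is responsible for the sign in [w3E]. The multipliers [u1], [u2],
   [u3] of the other direction need only agree where [c] resp. [d] is nonzero. *)
Section Cut.
Variables (R : realType) (k1 k2 l : nat) (w1 w2 w3 u1 u2 u3 : R -> R[i]).
Hypotheses (k1_gt0 : (0 < k1)%N) (k12 : (k1 <= k2)%N).
Hypotheses (mw1 : multiplier l w1) (mw2 : multiplier l w2).
Hypothesis w3E : forall t, w3 t = - (w1 t * w2 t).
Hypotheses (pu1 : forall s, u1 (s - k1%:R) = u1 s).
Hypotheses (pu2 : forall s, u2 (s - k2%:R) = u2 s).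
Hypotheses (pu3 : forall s, u3 (s - (k1 + k2)%:R) = u3 s).
Let c s : R[i] := (phi (s / k1%:R))%:C.
Let d s : R[i] := (psi (s / k1%:R))%:C.
Hypothesis u1u3 : forall s, 0 <= s <= k1%:R -> c s != 0 -> u1 s = u3 s.
Hypothesis u2u3' :
  forall s, 0 <= s <= k1%:R -> c s != 0 -> u2 s = u3 (s - k1%:R).
Hypothesis u1u3' :
  forall s, 0 <= s <= k1%:R -> d s != 0 -> u1 s = u3 (s - k1%:R).
Hypothesis u2u3 : forall s, 0 <= s <= k2%:R -> d s != 0 -> u2 s = u3 s.

Let k0 : 0 < k1%:R :> R. Proof. by rewrite ltr0n. Qed.
Let k2_gt0 : (0 < k2)%N. Proof. exact: leq_trans k12. Qed.
Let k20 : 0 < k2%:R :> R. Proof. by rewrite ltr0n. Qed.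
Let k_le : k1%:R <= k2%:R :> R. Proof. by rewrite ler_nat. Qed.
Let w10 t : w1 t != 0. Proof. by case: mw1. Qed.
Let w20 t : w2 t != 0. Proof. by case: mw2. Qed.
Let w30 t : w3 t != 0. Proof. by rewrite w3E oppr_eq0 mulf_neq0. Qed.

Let mw3 : multiplier l w3.
Proof.
have [c1 _ p1] := mw1; have [c2 _ p2] := mw2.
split=> [|t|t]; last 2 first.
- exact: w30.
- by rewrite !w3E p1 p2.
have -> : w3 = (fun t => - (w1 t * w2 t)) by apply/funext => t; rewrite w3E.
by move=> t; apply: cvgN; exact: (continuousM2 c1 c2).
Qed.

Let cd s : c s ^+ 2 + d s ^+ 2 = 1.
Proof. by rewrite /c /d -!rmorphXn -rmorphD phi2Dpsi2. Qed.

Let c0 s : k1%:R <= s -> c s = 0.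
Proof.
move=> ks; rewrite /c phi_eq0 // ger0_norm; last first.
  by rewrite divr_ge0 ?ltW // (lt_le_trans k0).
by rewrite ler_pdivlMr //; have := k0; lra.
Qed.

Let d1 s : k1%:R <= s -> d s = 1.
Proof.
move=> ks; rewrite /d psi_eq1 // ger0_norm; last first.
  by rewrite divr_ge0 ?ltW // (lt_le_trans k0).
by rewrite ler_pdivlMr //; have := k0; lra.
Qed.

Let c00 : c 0 = 1.
Proof. by rewrite /c mul0r phi_eq1 // normr0 invr_ge0. Qed.

Let d00 : d 0 = 0.
Proof. by rewrite /d mul0r psi_eq0 // normr0 invr_ge0. Qed.

Let continuous_c (T : topologicalType) (a : T -> R) :
  continuous a -> continuous (fun x => c (a x) : R[i]^o).
Proof.
move=> ca; apply: continuous_real_complex; apply: continuous_phi.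
exact: (continuousMr ca (@continuous_cst _ _ _)).
Qed.

Let continuous_d (T : topologicalType) (a : T -> R) :
  continuous a -> continuous (fun x => d (a x) : R[i]^o).
Proof.
move=> ca; apply: continuous_real_complex; apply: continuous_psi.
exact: (continuousMr ca (@continuous_cst _ _ _)).
Qed.

(** The factor [w1^-1] carries the value at [s - k1] back to [s]. The strip thus equals [h(0)] at
    [s = 0] and [w1^-1 h(0)] at [s = k1], which is the relation required on the circle of length
    [k1]. *)
Definition cut1_strip (h : fun2 R) : fun2 R := fun x =>
  c (x 0 0) * h x + d (x 0 0) * ((w1 (x 1 0))^-1 * h (pt (x 0 0 - k1%:R) (x 1 0))).
Definition cut2_strip (h : fun2 R) : fun2 R := fun x =>
  d (x 0 0) * h x - c (x 0 0) * ((w1 (x 1 0))^-1 * h (pt (x 0 0 - k1%:R) (x 1 0))).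
Definition cut1 (h : fun2 R) := ext 0 k1 w1 (cut1_strip h).
Definition cut2 (h : fun2 R) := ext 0 k2 w2 (cut2_strip h).

Let continuous_shifted (h : fun2 R) : continuous h -> continuous
  (fun x : 'cV[R]_2 => (w1 (x 1 0))^-1 * h (pt (x 0 0 - k1%:R) (x 1 0)) : R[i]^o).
Proof.
move=> ch; have [cw1 _ _] := mw1; apply: continuousM2.
  by apply: continuousV2 => [|x]; [exact: continuous_comp_coord|].
apply: (continuous_fun2 ch); last exact: continuous_coord.
by apply: continuousBr; [exact: continuous_coord|exact: continuous_cst].
Qed.

Lemma Z_cut1 h : Z (k1 + k2) w3 l u3 h -> Z k1 w1 l u1 (cut1 h).
Proof.
have [_ _ pw1] := mw1; have cx := @continuous_coord R 0.
move=> [ch hs ht]; apply: Z_ext; [exact: k1_gt0|exact: mw1| |exact: pu1| | ].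
- apply: continuousD2; apply: continuousM2;
    [exact: (continuous_c cx)|exact: ch|
     exact: (continuous_d cx)|exact: (continuous_shifted ch)].
- move=> t; rewrite /cut1_strip !pt0 !pt1 !add0r c00 d00 c0 // d1 //.
  by rewrite subrr !mul0r addr0 !mul1r add0r mulVKf.
- move=> s t; rewrite add0r => /andP[s0 sk]; rewrite /cut1_strip !pt0 !pt1 pw1 !ht.
  have Hs : 0 <= s <= k1%:R by rewrite s0 ltW.
  rewrite mulrDr; congr (_ + _).
    have [->|cn0] := eqVneq (c s) 0; first by rewrite !mul0r mulr0.
    by rewrite u1u3 // mulrCA.
  have [->|dn0] := eqVneq (d s) 0; first by rewrite !mul0r mulr0.
  by rewrite u1u3' //; ring.
Qed.

Let Z_cut2 h : Z (k1 + k2) w3 l u3 h -> Z k2 w2 l u2 (cut2 h).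
Proof.
have [_ _ pw1] := mw1; have cx := @continuous_coord R 0.
move=> [ch hs ht]; apply: Z_ext; [exact: k2_gt0|exact: mw2| |exact: pu2| | ].
- apply: continuousB2; apply: continuousM2;
    [exact: (continuous_d cx)|exact: ch|
     exact: (continuous_c cx)|exact: (continuous_shifted ch)].
- move=> t; rewrite /cut2_strip !pt0 !pt1 !add0r c00 d00 c0 // d1 //.
  (* Only [- w1^-1 h(- k1)] remains at the left edge and [h(k2)] at the right one, and these points
     differ by the full period [k1 + k2]: here [w3 = - w1 w2] is forced. *)
  have := hs k2%:R t; rewrite natrD opprD addrA (_ : _ - _ - _ = - k1%:R).
    by move=> ->; rewrite w3E; field; exact: w10.
  by ring.
- move=> s t; rewrite add0r => /andP[s0 sk]; rewrite /cut2_strip !pt0 !pt1 pw1 !ht.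
  have Hs : 0 <= s <= k2%:R by rewrite s0 ltW.
  rewrite mulrBr; congr (_ - _).
    have [->|dn0] := eqVneq (d s) 0; first by rewrite !mul0r mulr0.
    by rewrite u2u3 // mulrCA.
  have [->|cn0] := eqVneq (c s) 0; first by rewrite !mul0r mulr0.
  have sk1 : s <= k1%:R.
    by rewrite leNgt; apply/negP => /ltW /c0 cs0; rewrite cs0 eqxx in cn0.
  by rewrite u2u3' ?s0 //; ring.
Qed.

(** The matrix of the cut is its own inverse, so its rows also describe the gluing: the first gives
    the values on [[0, k2]], the second, moved back by [k1], those on [[- k1, 0]]. There the factor
    [w1] of [f] is absorbed by evaluating [f] at [s] instead of [s + k1]. *)
Definition join_strip (f g : fun2 R) : fun2 R := fun x =>
  if x 0 0 <= 0 then
    d (x 0 0 + k1%:R) * f x -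
    w1 (x 1 0) * c (x 0 0 + k1%:R) * g (pt (x 0 0 + k1%:R) (x 1 0))
  else c (x 0 0) * f x + d (x 0 0) * g x.
Definition join f g := ext (- k1%:R) (k1 + k2) w3 (join_strip f g).

Let join_strip_ge0 f g s t : 0 <= s ->
  join_strip f g (pt s t) = c s * f (pt s t) + d s * g (pt s t).
Proof.
move=> s0; rewrite /join_strip !pt0 !pt1; case: ifP => // s0'.
have -> : s = 0 by apply/eqP; rewrite eq_le s0 s0'.
by rewrite add0r c0 // d1 // c00 d00 mulr0 !mul0r subr0 addr0.
Qed.

Let join_strip_le0 f g s t : s <= 0 ->
  join_strip f g (pt s t) = d (s + k1%:R) * f (pt s t) -
    w1 t * c (s + k1%:R) * g (pt (s + k1%:R) t).
Proof. by move=> s0; rewrite /join_strip !pt0 !pt1 s0. Qed.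

Let Z_join f g : Z k1 w1 l u1 f -> Z k2 w2 l u2 g ->
  Z (k1 + k2) w3 l u3 (join f g).
Proof.
have [cw1 _ pw1] := mw1.
move=> [cf fs ft] [cg gs gt]; apply: Z_ext; [|exact: mw3| |exact: pu3| | ].
- by rewrite addn_gt0 k1_gt0.
- have cx := @continuous_coord R 0.
  have cxk : continuous (fun x : 'cV[R]_2 => x 0 0 + k1%:R).
    exact: (continuousDr cx (@continuous_cst _ _ _)).
  apply: (@continuous_glue R _ _ (fun x : 'cV[R]_2 => x 0 0) 0);
    first exact: cx.
  + apply: continuousB2.
      by apply: continuousM2; [exact: (continuous_d cxk)|exact: cf].
    apply: continuousM2; first apply: continuousM2.
    * exact: continuous_comp_coord.
    * exact: (continuous_c cxk).
    * exact: (continuous_fun2 cg cxk (@continuous_coord R 1)).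
  + apply: continuousD2; apply: continuousM2;
      [exact: (continuous_c cx)|exact: cf|exact: (continuous_d cx)|exact: cg].
  + move=> x x0; rewrite x0 add0r c0 // d1 // c00 d00.
    by rewrite mulr0 !mul0r subr0 addr0.
- move=> t; rewrite join_strip_le0; last by rewrite oppr_le0 ltW.
  rewrite addNr natrD addrA addNr add0r join_strip_ge0 ?ltW //.
  rewrite c00 d00 c0 // d1 // w3E.
  by have := gs k2%:R t; rewrite subrr => ->; ring.
- move=> s t; rewrite natrD addrA addNr add0r => /andP[s0 sk].
  have [sle0|sgt0] := lerP s 0.
    have Hs : 0 <= s + k1%:R <= k1%:R by apply/andP; split; lra.
    rewrite !join_strip_le0 // pw1 ft gt mulrBr; congr (_ - _).
      have [->|dn0] := eqVneq (d (s + k1%:R)) 0; first by rewrite !mul0r mulr0.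
      have := u1u3' Hs dn0; rewrite -[in LHS]pu1 addrK => ->.
      by rewrite mulrCA.
    have [->|cn0] := eqVneq (c (s + k1%:R)) 0.
      by rewrite mulr0 !mul0r mulr0.
    by have := u2u3' Hs cn0; rewrite addrK => ->; rewrite mulrCA.
  have s0' := ltW sgt0.
  have Hs : 0 <= s <= k2%:R by rewrite s0' ltW.
  rewrite !join_strip_ge0 // ft gt mulrDr; congr (_ + _).
    have [->|cn0] := eqVneq (c s) 0; first by rewrite !mul0r mulr0.
    have sk1 : s <= k1%:R.
      by rewrite leNgt; apply/negP => /ltW /c0 cs0; rewrite cs0 eqxx in cn0.
    by rewrite u1u3 ?s0' // mulrCA.
  have [->|dn0] := eqVneq (d s) 0; first by rewrite !mul0r mulr0.
  by rewrite u2u3 // mulrCA.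
Qed.

Let K_gt0 : (0 < k1 + k2)%N. Proof. by rewrite addn_gt0 k1_gt0. Qed.

Let join_window f g s t : - k1%:R <= s < k2%:R ->
  join f g (pt s t) = join_strip f g (pt s t).
Proof. by move=> ?; rewrite /join ext_window // natrD addrA addNr add0r. Qed.

Let cut1_join f g : Z k1 w1 l u1 f -> Z k2 w2 l u2 g -> cut1 (join f g) = f.
Proof.
move=> Zf Zg; have [_ fs _] := Zf.
apply: (Z_eq (a := 0) k1_gt0 w10 (Z_cut1 (Z_join Zf Zg)) Zf) => s t Hs.
rewrite /cut1 ext_window //; move: Hs; rewrite add0r => /andP[s0 sk].
have Hs : - k1%:R <= s < k2%:R by have := k_le; have := k20; lra.
have Hs' : - k1%:R <= s - k1%:R < k2%:R by have := k20; lra.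
rewrite /cut1_strip !pt0 !pt1 !join_window //.
rewrite join_strip_ge0 // join_strip_le0; last by lra.
rewrite subrK fs -[RHS]mul1r -(cd s).
by field; exact: w10.
Qed.

Let cut2_join f g : Z k1 w1 l u1 f -> Z k2 w2 l u2 g -> cut2 (join f g) = g.
Proof.
move=> Zf Zg; have [_ fs _] := Zf.
apply: (Z_eq (a := 0) k2_gt0 w20 (Z_cut2 (Z_join Zf Zg)) Zg) => s t Hs.
rewrite /cut2 ext_window //; move: Hs; rewrite add0r => /andP[s0 sk].
rewrite /cut2_strip !pt0 !pt1 join_window; last first.
  by have := k_le; have := k0; have := k20; lra.
rewrite join_strip_ge0 //; have [sk1|sk1] := lerP k1%:R s.
  by rewrite c0 // d1 // !mul0r !mul1r add0r subr0.
rewrite join_window; last by have := k_le; have := k0; have := k20; lra.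
rewrite join_strip_le0; last by lra.
rewrite subrK fs -[RHS]mul1r -(cd s).
by field; exact: w10.
Qed.

(** Applying the matrix once more recovers [h] at [s] and [s - k1] from the two cuts; beyond [k1]
    the second cut is [h] itself. *)
Let cut_eq0 h : Z (k1 + k2) w3 l u3 h -> cut1 h = 0 -> cut2 h = 0 -> h = 0.
Proof.
move=> Zh h1 h2.
have Z0 : Z (k1 + k2) w3 l u3 0.
  by have /submoduleP[] := submodule_Z (k1 + k2) w3 l u3.
have E1 s t : 0 <= s < k1%:R -> cut1_strip h (pt s t) = 0.
  by move=> Hs; rewrite -(@ext_window _ 0 k1 w1) ?add0r // -/(cut1 h) h1.
have E2 s t : 0 <= s < k2%:R -> cut2_strip h (pt s t) = 0.
  by move=> Hs; rewrite -(@ext_window _ 0 k2 w2) ?add0r // -/(cut2 h) h2.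
have E s t : 0 <= s < k1%:R -> h (pt s t) = 0 /\ h (pt (s - k1%:R) t) = 0.
  move=> /andP[s0 sk].
  have e1 : cut1_strip h (pt s t) = 0 by apply: E1; rewrite s0.
  have e2 : cut2_strip h (pt s t) = 0.
    by apply: E2; rewrite s0 (lt_le_trans sk).
  move: e1 e2; rewrite /cut1_strip /cut2_strip !pt0 !pt1 => e1 e2; split.
    rewrite -[LHS]mul1r -(cd s).
    rewrite (_ : _ * _ = c s * 0 + d s * 0); last by rewrite -{1}e1 -e2; ring.
    by rewrite !mulr0 addr0.
  apply: (mulfI (invr_neq0 (w10 t))); rewrite mulr0 -[LHS]mul1r -(cd s).
  rewrite (_ : _ * _ = d s * 0 - c s * 0); last by rewrite -{1}e1 -e2; ring.
  by rewrite !mulr0 subrr.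
apply: (Z_eq (a := - k1%:R) K_gt0 w30 Zh Z0) => s t.
rewrite natrD addrA addNr add0r => /andP[s1 s2].
have [s0|s0] := lerP 0 s; last first.
  have [|_] := E (s + k1%:R) t; first by apply/andP; split; lra.
  by rewrite addrK.
have [sk|sk] := lerP k1%:R s; last by have [|->] := E s t; rewrite ?s0.
have := E2 s t; rewrite s0 s2 => /(_ isT); rewrite /cut2_strip !pt0 !pt1.
by rewrite c0 // d1 // mul0r subr0 mul1r.
Qed.

Let cut_linear (a : torus_fun R) (h h' : fun2 R) :
  cut1 (a *: h + h') = a *: cut1 h + cut1 h' /\
  cut2 (a *: h + h') = a *: cut2 h + cut2 h'.
Proof.
rewrite /cut1 /cut2 -!ext_linear.
have ap s t : torus_val a (pt (s - k1%:R) t) = torus_val a (pt s t).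
  by rewrite -[k1%:R]/(k1%:~R) torus_valBs.
split; congr ext; apply: fun2P => s t;
  rewrite fun2DE fun2ZE /cut1_strip /cut2_strip !pt0 !pt1 !fun2DE !fun2ZE ap;
  by ring.
Qed.

(** [U] leaves room for a second cut, applied to the first piece. For [U] equal to 0 or to the
    kernel of such a cut, the splitting describes the kernel of one cut or of a composite of two. *)
Lemma cut_iso (U : set (fun2 R)) : submodule U -> U `<=` Z k1 w1 l u1 ->
  module_iso [set h | Z (k1 + k2) w3 l u3 h /\ U (cut1 h)]
             (U `*` Z k2 w2 l u2).
Proof.
move=> sU UZ; have [U0 UD] := (submoduleP U).1 sU.
have [Z0 ZD] := (submoduleP _).1 (submodule_Z (k1 + k2) w3 l u3).
have cut10 : cut1 0 = 0.
  have [] := cut_linear 1 0 0; rewrite !scale1r addr0.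
  by move=> /(congr1 (+%R^~ (- cut1 0))); rewrite addrK subrr => /esym.
apply: (@module_iso_lker _ _ _ _ _ (fun h => (cut1 h, cut2 h))).
- apply/submoduleP; split; first by rewrite /= cut10.
  move=> a h h' [Zh Uh] [Zh' Uh']; split; first exact: ZD.
  by have [-> _] := cut_linear a h h'; exact: UD.
- by apply: submodule_prod => //; exact: submodule_Z.
- by move=> h [Zh Uh]; split => //=; exact: Z_cut2.
- by move=> a h h' _ _; have [-> ->] := cut_linear a h h'.
- by move=> h [Zh _] [h1 h2]; exact: cut_eq0.
- move=> [f g] [/= Uf Zg]; exists (join f g); last first.
    by rewrite cut1_join ?cut2_join //; exact: UZ.
  by split; [apply: Z_join => //; exact: UZ|rewrite cut1_join //; exact: UZ].
Qed.

Lemma cut1E h s t : 0 <= s < k1%:R -> cut1 h (pt s t) =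
  c s * h (pt s t) + d s * ((w1 t)^-1 * h (pt (s - k1%:R) t)).
Proof.
by move=> Hs; rewrite /cut1 ext_window ?add0r // /cut1_strip !pt0 !pt1.
Qed.

Lemma Z_cut1_iso : module_iso (Z (k1 + k2) w3 l u3) (Z k1 w1 l u1 `*` Z k2 w2 l u2).
Proof.
have sub : Z k1 w1 l u1 `<=` Z k1 w1 l u1 by [].
have := cut_iso (submodule_Z k1 w1 l u1) sub.
rewrite (_ : [set h | _ /\ _] = Z (k1 + k2) w3 l u3); first exact.
by apply/seteqP; split=> [h [] //|h Zh]; split; [exact: Zh|exact: Z_cut1].
Qed.

End Cut.

(** * Classification by rank and degree *)

Section Classification.
Variable R : realType.
Implicit Types (f g : fun2 R) (s t : R) (k l : nat) (a b : int).

Lemma multiplier_cst l (z : R[i]) : z != 0 -> multiplier l (fun _ : R => z).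
Proof. by move=> z0; split=> //; exact: (@continuous_cst R R[i]^o z). Qed.

Lemma multiplier_e l b (chi : R -> R) : continuous chi ->
  (forall t, chi (t - l%:R) = chi t - b%:~R) ->
  multiplier l (fun t => e (chi t)).
Proof.
move=> cchi chil; split=> [|t|t]; [exact: continuous_e|exact: e_neq0|].
by rewrite chil -mulrNz; exact: (@eB_int _ _ _ (- b)).
Qed.

Lemma multiplierN l (w : R -> R[i]) : multiplier l w -> multiplier l (fun t => - w t).
Proof.
move=> [cw w0 pw]; split=> [t|t|t]; first by apply: cvgN; exact: cw.
  by rewrite oppr_eq0.
by rewrite pw.
Qed.

Let continuous_linear (c : R) : continuous (fun t : R => c * t).
Proof. by apply: continuousMr; [exact: continuous_cst|move=> t; exact: cvg_id]. Qed.

Let continuous_linear_div l (c : R) : continuous (fun t : R => c * t / l%:R).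
Proof.
by apply: continuousMr; [exact: continuous_linear|exact: continuous_cst].
Qed.

(* The model of the modules of rank [k * l] and degree [b]: its sections live
   on the torus of periods [k] and [l]. *)
Definition N k l b : set (fun2 R) :=
  Z k (fun t => e (- b%:~R * t / l%:R)) l (fun=> 1).

Lemma submodule_N k l b : submodule (N k l b).
Proof. exact: submodule_Z. Qed.

Lemma multiplier_N l b : (0 < l)%N ->
  multiplier l (fun t : R => e (- b%:~R * t / l%:R)).
Proof.
move=> l0; apply: (@multiplier_e _ (- b)); first exact: continuous_linear_div.
move=> t; rewrite mulrNz; field; by rewrite pnatr_eq0 -lt0n.
Qed.

(* Multiplication by [e (chi s * t / l)] moves the twist to the other period. *)
Lemma Z_degree k l b (chi : R -> R) : (0 < l)%N -> continuous chi ->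
  (forall s, chi (s - k%:R) = chi s - b%:~R) ->
  module_iso (Z k (fun=> 1) l (fun s => e (chi s))) (N k l b).
Proof.
move=> l0 cchi chik; have ln0 : l%:R != 0 :> R by rewrite pnatr_eq0 -lt0n.
apply: (@Z_gauge R k _ _ l _ _ (fun x => e (chi (x 0 0) * x 1 0 / l%:R))).
- apply: continuous_e; apply: continuousMr; last exact: continuous_cst.
  apply: continuousMr; last exact: continuous_coord.
  move=> x; apply: (@continuous_comp _ _ _ (fun x : 'cV[R]_2 => x 0 0) chi).
    exact: continuous_coord.
  exact: cchi.
- by move=> x; exact: e_neq0.
- move=> s t; rewrite !pt0 !pt1 mulr1 chik -eD; congr e; ring.
- move=> s t; rewrite !pt0 !pt1 mul1r -eD; congr e; field; exact: ln0.
Qed.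

Lemma X_N q a : (0 < q)%N -> module_iso (X q a) (N 1 q a).
Proof.
move=> q0; have -> : X q a = Z 1 (fun=> 1) q (fun s => e (a%:~R * s)).
  apply/seteqP; split=> f [cf fs ft]; split=> // s t.
    by rewrite mul1r -{2}[s](subrK 1) fs.
  by rewrite -{2}[s](addrK 1) fs mul1r.
apply: (@Z_degree 1 q a ( *%R a%:~R)) => [//| |s].
  exact: continuous_linear.
by rewrite mulrBr mulr1.
Qed.

(** The sign is removed by a phase that makes half a turn over the period [k]. *)
Lemma Z_sign k (w : R -> R[i]) l (u : R -> R[i]) : (0 < k)%N ->
  module_iso (Z k (fun t => - w t) l u) (Z k w l u).
Proof.
move=> k0; have kn0 : k%:R != 0 :> R by rewrite pnatr_eq0 -lt0n.
apply: (@Z_gauge R k _ _ l _ _ (fun x => e (x 0 0 / (2 * k%:R)))).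
- apply: continuous_e; apply: continuousMr; last exact: continuous_cst.
  exact: continuous_coord.
- by move=> x; exact: e_neq0.
- move=> s t; rewrite !pt0 mulrBl eD.
  rewrite (_ : - (k%:R / (2 * k%:R)) = 2^-1 - 1); last by field; exact: kn0.
  by rewrite eD e_half eN1; ring.
- by move=> s t; rewrite !pt0 mulrC.
Qed.

Let N_cut k1 k2 l b1 b2 : (0 < k1)%N -> (k1 <= k2)%N -> (0 < l)%N ->
  module_iso (N (k1 + k2) l (b1 + b2)) (N k1 l b1 `*` N k2 l b2).
Proof.
move=> k10 k12 l0; have k20 := leq_trans k10 k12.
(* The second piece first gets the opposite multiplier, which cancels the sign in the gluing
   condition of a cut. *)
apply: (@module_iso_trans _ _ _ _ _ (N k1 l b1 `*`
    Z k2 (fun t => - e (- b2%:~R * t / l%:R)) l (fun=> 1))); last first.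
  apply: module_iso_prod; first exact/module_iso_refl/submodule_N.
  exact: Z_sign.
apply: Z_cut1_iso => //; first exact: multiplier_N.
  exact/multiplierN/multiplier_N.
move=> t; rewrite mulrN opprK -eD; congr e; rewrite intrD.
by field; rewrite pnatr_eq0 -lt0n.
Qed.

Lemma N_addk k1 k2 l b1 b2 : (0 < k1)%N -> (0 < k2)%N -> (0 < l)%N ->
  module_iso (N (k1 + k2) l (b1 + b2)) (N k1 l b1 `*` N k2 l b2).
Proof.
move=> k10 k20 l0; have [k12|/ltnW k21] := leqP k1 k2; first exact: N_cut.
rewrite addnC addrC; apply: module_iso_trans (N_cut _ _ k20 k21 l0) _.
by apply: module_iso_prodC; exact: submodule_N.
Qed.

(** Exchanging the coordinates reverses the orientation of the torus, and with it the sign of the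
    degree. *)
Lemma N_swap k l b : (0 < k)%N -> (0 < l)%N ->
  module_iso (pull swap @` N l k (- b)) (N k l b).
Proof.
move=> k0 l0; rewrite pull_swap_Z.
have kn0 : k%:R != 0 :> R by rewrite pnatr_eq0 -lt0n.
apply: (@Z_degree k l b (fun s => - (- b)%:~R * s / k%:R)) => [//| |s].
  exact: continuous_linear_div.
by rewrite mulrNz opprK; field; exact: kn0.
Qed.

Lemma N_addl k l1 l2 b1 b2 : (0 < k)%N -> (0 < l1)%N -> (0 < l2)%N ->
  module_iso (N k (l1 + l2) (b1 + b2)) (N k l1 b1 `*` N k l2 b2).
Proof.
move=> k0 l10 l20; have l0 : (0 < l1 + l2)%N by rewrite addn_gt0 l10.
apply: module_iso_trans (module_iso_sym (N_swap _ k0 l0)) _.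
apply: (module_iso_trans _ (module_iso_prod (N_swap b1 k0 l10) (N_swap b2 k0 l20))).
apply: module_iso_pull_prod; [exact: swapK|exact: swapK|].
by rewrite opprD; exact: N_addk.
Qed.

(** The torus is cut along [s] into strips of width 1, which are joined again along [t]. The whole
    degree is kept in one strip. *)
Lemma N_flatten k l b : (0 < k)%N -> (0 < l)%N ->
  module_iso (N k l b) (N 1 (k * l) b).
Proof.
move=> + l0; case: k => // k _; elim: k => [|k IHk].
  by rewrite mul1n; exact/module_iso_refl/submodule_N.
rewrite -[k.+2]addn1 -[b]addr0.
apply: module_iso_trans (N_addk _ _ _ _ l0) _ => //.
apply: (module_iso_trans (module_iso_prod IHk
  (module_iso_refl (submodule_N 1 l 0)))).
by rewrite mulnDl mul1n; apply/module_iso_sym/N_addl => //; rewrite muln_gt0.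
Qed.

Lemma X_add q1 q2 a1 a2 : (0 < q1)%N -> (0 < q2)%N ->
  module_iso (X q1 a1 `*` X q2 a2) (X (q1 + q2) (a1 + a2) : set (fun2 R)).
Proof.
move=> q10 q20.
apply: module_iso_trans (module_iso_prod (X_N _ q10) (X_N _ q20)) _.
apply: (module_iso_trans (module_iso_sym (N_addl _ _ _ q10 q20))) => //.
by apply/module_iso_sym/X_N; rewrite addn_gt0 q10.
Qed.

Lemma submodule_X q a : (0 < q)%N -> submodule (X q a : set (fun2 R)).
Proof. by move=> q0; have [] := X_N a q0. Qed.

(** * Invariance under SL(2, Z) *)

Lemma eXz (x : R) (n : int) : e x ^ n = e (n%:~R * x).
Proof.
have pos (m : nat) : e x ^+ m = e (m%:R * x).
  elim: m => [|m IHm]; first by rewrite mul0r e0.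
  by rewrite exprSr IHm -eD -addn1 natrD mulrDl mul1r.
case: n => n; first exact: pos.
by rewrite NegzE mulrNz mulNr -eV -(pos n.+1).
Qed.

(** A matrix in SL(2, Z) mixes the two periods, so a pull-back calls for the cocycle on the whole
    lattice and not just on two generators. *)
Lemma X1P b f : X 1 b f <-> continuous f /\
  forall (p : 'cV[int]_2) x,
    f (x - intvec R p) = e (b%:~R * (p 1 0)%:~R * x 0 0) * f x.
Proof.
split=> [[cf fs ft]|[cf fp]]; split=> //.
- move=> p x; rewrite (pt_eta x) ptB_intvec !pt0; move: (x 0 0) (x 1 0) => s t.
  have Hs t' s' : f (pt (s' - 1) t') = 1 * f (pt s' t').
    by rewrite mul1r -{2}[s'](subrK 1) fs.
  have := quasi_shift (oner_neq0 _) (Hs (t - (p 1 0)%:~R)) (p 0 0) s.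
  rewrite mulr1 exp1rz mul1r => ->.
  have := quasi_shift (e_neq0 _) (ft s) (p 1 0) t.
  by rewrite mulr1 eXz => ->; congr (e _ * _); ring.
- move=> s t; have := fp (\col_i (if i == 0 then -1 else 0)) (pt s t).
  by rewrite ptB_intvec !mxE /= mulr0 mul0r e0 mul1r subr0 opprK.
- move=> s t; have := fp (\col_i (if i == 0 then 0 else 1)) (pt s t).
  by rewrite ptB_intvec !mxE /= mulr1 subr0.
Qed.

Lemma even_consecutive (m : int) : exists c : int, m * (m - 1) = 2 * c.
Proof.
have [k [->|->]] : exists k : int, m = 2 * k \/ m = 2 * k + 1.
- by exists (m %/ 2)%Z; lia.
- by exists (k * (2 * k - 1)); ring.
- by exists ((2 * k + 1) * k); ring.
Qed.

Lemma det_mx2 (K : comNzRingType) (M : 'M[K]_2) :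
  \det M = M 0 0 * M 1 1 - M 0 1 * M 1 0.
Proof.
rewrite (expand_det_row _ 0) !big_ord_recl big_ord0 addr0.
rewrite /cofactor !det_mx11 !mxE /= expr0 expr1 mul1r mulN1r mulrN.
by congr (_ * M _ _ - M _ _ * M _ _); exact: val_inj.
Qed.

Lemma mulmx2E (K : comNzRingType) (M : 'M[K]_2) (p : 'cV[K]_2) i :
  (M *m p) i 0 = M i 0 * p 0 0 + M i 1 * p 1 0.
Proof.
rewrite mxE !big_ord_recl big_ord0 addr0.
by congr (_ * _ + M _ _ * p _ _); exact: val_inj.
Qed.

Section Pullback.
Variables (J J' : 'M[int]_2) (b : int).
Hypotheses (detJ : \det J = 1) (JJ' : J *m J' = 1%:M) (J'J : J' *m J = 1%:M).

(** Since [\det J = 1], the difference of the two cocycles is given by a symmetric bilinear form.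
    [Q] is half its quadratic form plus linear terms, which turn the increments [m ^ 2 / 2] into the
    integers [m (m - 1) / 2]. *)
Let Q (x : 'cV[R]_2) : R :=
  let s := x 0 0 in let t := x 1 0 in
  let A := (J 0 0)%:~R in let B := (J 0 1)%:~R in
  let C := (J 1 0)%:~R in let D := (J 1 1)%:~R in
  b%:~R / 2 * (C * A * (s * s + s) + 2 * C * B * (s * t)
               + D * B * (t * t + t)).

Let detJE : (J 0 0)%:~R * (J 1 1)%:~R - (J 0 1)%:~R * (J 1 0)%:~R = 1 :> R.
Proof. by rewrite -!intrM -intrB -[RHS]/(1%:~R) -detJ det_mx2. Qed.

(* [Q] is chosen so that its increments along [intvec R p] compensate, modulo
   integers, the difference between the cocycles of [X 1 b] and of its
   pull-back. *)
Let eQ (p : 'cV[int]_2) x :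
  e (Q (x - intvec R p)) * e (b%:~R * ((J *m p) 1 0)%:~R *
     (map_mx intr J *m x) 0 0) = e (b%:~R * (p 1 0)%:~R * x 0 0) * e (Q x).
Proof.
have [c1 E1] := even_consecutive (p 0 0).
have [c2 E2] := even_consecutive (p 1 0).
have {}E1 : (p 0 0)%:~R * ((p 0 0)%:~R - 1) = 2 * c1%:~R :> R.
  by rewrite -[2]/(2%:~R) -intrM -E1 intrM intrB.
have {}E2 : (p 1 0)%:~R * ((p 1 0)%:~R - 1) = 2 * c2%:~R :> R.
  by rewrite -[2]/(2%:~R) -intrM -E2 intrM intrB.
rewrite -!eD; apply: (eB_int (n := b * (J 1 0 * J 0 0 * c1 + J 1 1 * J 0 1 * c2
   + J 1 0 * J 0 1 * p 0 0 * p 1 0))).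
rewrite !mulmx2E /Q !mxE !(intrD, intrM); have := detJE.
move: (x 0 0) (x 1 0) E1 E2 => s t.
move: (J 0 0)%:~R (J 0 1)%:~R (J 1 0)%:~R (J 1 1)%:~R => A B C D.
move: (p 0 0)%:~R (p 1 0)%:~R c1%:~R c2%:~R => m n {}c1 {}c2 E1 E2 det.
have -> : c1 = m * (m - 1) / 2 by rewrite E1; field.
have -> : c2 = n * (n - 1) / 2 by rewrite E2; field.
(* With the determinant inserted into the one term free of [J], the identity becomes polynomial. *)
have -> : b%:~R * n * s = b%:~R * n * s * (A * D - B * C) by rewrite det mulr1.
by field.
Qed.

Let continuous_eQ : continuous (fun x => e (Q x) : R[i]^o).
Proof.
have c0 := @continuous_coord R 0; have c1 := @continuous_coord R 1.
have cM c (h : 'cV[R]_2 -> R) : continuous h -> continuous (fun x => c * h x).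
  by move=> ch; apply: continuousMr; [exact: continuous_cst|exact: ch].
have cD (a b : 'cV[R]_2 -> R) := @continuousDr R _ a b.
have cP (a b : 'cV[R]_2 -> R) := @continuousMr R _ a b.
apply: continuous_e; apply/cM/cD; last exact/cM/(cD _ _ (cP _ _ c1 c1) c1).
apply: (@cD); apply: (@cM); last exact: (cP _ _ c0 c1).
exact: (cD _ _ (cP _ _ c0 c0) c0).
Qed.

Lemma X1_pull : module_iso (pull J @` X 1 b) (X 1 b : set (fun2 R)).
Proof.
have sX : submodule (X 1 b : set (fun2 R)) by exact: submodule_X.
apply/module_isoP; split=> //.
  by have [] := module_iso_pull JJ' J'J (module_iso_refl sX).
exists (fun g x => e (Q x) * g x), (fun f x => (e (Q x))^-1 * f x); split.
- move=> _ [f /X1P[cf fp] <-]; apply/X1P; split.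
    exact: (continuousM2 continuous_eQ (continuous_pull (J := J) cf)).
  move=> p x; have := fp (J *m p) (map_mx intr J *m x).
  rewrite /pull mulmxBr /intvec map_mxM => ->.
  by rewrite mulrA eQ mulrA.
- move=> f /X1P[cf fp].
  pose g : fun2 R := fun x => (e (Q x))^-1 * f x.
  exists (pull J' g); last by rewrite pullM J'J pull1.
  apply/X1P; split.
    apply: continuous_pull; apply: (continuousM2 _ cf).
    by apply: continuousV2 => [|x]; [exact: continuous_eQ|exact: e_neq0].
  move=> p x; rewrite /pull.
  set y := map_mx intr J' *m x.
  have -> : map_mx intr J' *m (x - intvec R p) = y - intvec R (J' *m p).
    by rewrite mulmxBr /intvec map_mxM.
  have xE : x = map_mx intr J *m y.
    by rewrite /y mulmxA -map_mxM JJ' map_mx1 mul1mx.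
  rewrite {1}xE /g fp; have := eQ (J' *m p) y.
  rewrite mulmxA JJ' mul1mx => /esym /(canRL (mulfK (e_neq0 _))) ->.
  by field; rewrite !e_neq0.
- by move=> g _; apply/funext => x; rewrite mulKf ?e_neq0.
- by move=> g _; apply/funext => x; rewrite mulVKf ?e_neq0.
- move=> h f g _ _; apply/funext => x.
  by rewrite !fun2DE !fun2ZE mulrDr mulrCA.
Qed.

End Pullback.

(** Only rank one needs a phase: for larger [q] the degree is kept in a summand [X 1 a], and the
    other summand has smaller rank and degree 0. *)
Lemma X_pull (J J' : 'M[int]_2) q a : \det J = 1 ->
  J *m J' = 1%:M -> J' *m J = 1%:M -> (0 < q)%N ->
  module_iso (pull J @` X q a) (X q a : set (fun2 R)).
Proof.
move=> detJ JJ' J'J; case: q => // q _; elim: q a => [|q IHq] a.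
  exact: (X1_pull a detJ JJ' J'J).
have add : module_iso (X 1 a `*` X q.+1 0) (X q.+2 a : set (fun2 R)).
  by have := @X_add 1 q.+1 a 0 isT isT; rewrite addr0.
apply: (module_iso_trans _ add).
apply: (module_iso_trans (module_iso_pull_prod JJ' J'J (module_iso_sym add))).
by apply: module_iso_prod; [exact: (X1_pull a detJ JJ' J'J)|exact: IHq].
Qed.

(** * Free modules and projectivity *)

Lemma module_iso_row m n :
  module_iso [set: 'rV[torus_fun R]_(m + n)]
    ([set: 'rV[torus_fun R]_m] `*` [set: 'rV[torus_fun R]_n]).
Proof.
have sT (E : lmodType (torus_fun R)) : submodule [set: E].
  by apply/submoduleP.
apply/module_isoP; split; [exact: sT|by apply: submodule_prod; exact: sT|].
exists (fun u => (lsubmx u, rsubmx u)), (fun u => row_mx u.1 u.2); split=> //.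
- by move=> u _; exact: hsubmxK.
- by move=> [u v] _; rewrite row_mxKl row_mxKr.
- by move=> c u v _ _; congr pair; apply/rowP => i; rewrite !mxE.
Qed.

Let X_free1 : module_iso (X 1 0 : set (fun2 R)) [set: 'rV[torus_fun R]_1].
Proof.
apply: module_iso_sym.
apply: (@module_iso_lker R 'rV[torus_fun R]_1 (fun2 R) _ _
  (fun v => torus_val (v 0 0))).
- by apply/submoduleP.
- exact: submodule_X.
- move=> v _; apply/X1P; split; first exact: continuous_torus.
  move=> p x; rewrite !mul0r e0 mul1r (pt_eta x) ptB_intvec.
  exact: torus_valB.
- by move=> h u v _ _; rewrite !mxE.
- move=> v _ v0; apply/rowP => i; rewrite ord1 mxE; apply: val_inj.
  exact: v0.
- move=> f /X1P[cf fp].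
  have tf : f \in @torus_pred R.
    rewrite inE; split=> // p x; rewrite fp.
    by rewrite !mul0r e0 mul1r.
  by exists (\row_i TorusFun tf) => //; rewrite mxE.
Qed.

Lemma X_free q : (0 < q)%N ->
  module_iso (X q 0 : set (fun2 R)) [set: 'rV[torus_fun R]_q].
Proof.
case: q => // q _; elim: q => [|q IHq]; first exact: X_free1.
have add := @X_add 1 q.+1 0 0 isT isT; rewrite addr0 in add.
apply: (module_iso_trans (module_iso_sym add)).
apply: (module_iso_trans _ (module_iso_sym (module_iso_row 1 q.+1))).
by apply: module_iso_prod; [exact: X_free1|exact: IHq].
Qed.

Lemma fg_projective_summand (E E' : lmodType (torus_fun R)) (V : set E)
    (W : set E') n : submodule V -> submodule W ->
  module_iso (V `*` W) [set: 'rV[torus_fun R]_n] -> fg_projective V.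
Proof.
move=> sV sW /module_iso_sym /module_isoP[_ _ [f [g [fV gV gK fK lf]]]].
have [V0 VD] := (submoduleP V).1 sV; have [W0 WD] := (submoduleP W).1 sW.
have f0 : f 0 = 0.
  have := lf 1 0 0 I I; rewrite !scale1r addr0.
  by move=> /(congr1 (+%R^~ (- f 0))); rewrite addrK subrr => /esym.
pose P := [set u | (f u).2 = 0]; pose Q := [set u | (f u).1 = 0].
have sP : submodule P.
  apply/submoduleP; split; first by rewrite /P /= f0.
  by move=> h u v uP vP; rewrite /P /= lf //= uP vP scaler0 addr0.
have sQ : submodule Q.
  apply/submoduleP; split; first by rewrite /Q /= f0.
  by move=> h u v uQ vQ; rewrite /Q /= lf //= uQ vQ scaler0 addr0.
have fD u v : f (u + v) = f u + f v.
  by have := lf 1 u v I I; rewrite !scale1r.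
exists n, P, Q; split=> //.
- move=> u; have [Vu Wu] := fV u I.
  exists (g ((f u).1, 0)), (g (0, (f u).2)).
  have V1 : (V `*` W) ((f u).1, 0) by [].
  have V2 : (V `*` W) (0, (f u).2) by [].
  rewrite /P /Q /= !fK //; split=> //.
  rewrite -[LHS]gK // -[RHS]gK // fD !fK //; congr g.
  by rewrite [LHS]surjective_pairing; congr pair; rewrite /= ?addr0 ?add0r.
- apply/seteqP; split=> [u [Pu Qu]|_ ->]; last by rewrite /P /Q /= f0.
  by rewrite /= -[u]gK // -[RHS]gK // f0 [f u]surjective_pairing Pu Qu.
- apply: module_iso_sym; apply/module_isoP; split=> //.
  exists (fun u => (f u).1), (fun v => g (v, 0)); split.
  + by move=> u _; have [] := fV u I.
  + by move=> v Vv; rewrite /P /= fK.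
  + move=> u Pu; rewrite -[RHS]gK //; congr g.
    by rewrite [RHS]surjective_pairing Pu.
  + by move=> v Vv; rewrite fK.
  + by move=> h u v _ _; rewrite lf.
Qed.

(** [X q (- a)] is a complement: the degrees cancel, and in degree 0 the module of rank [q + q] is
    free. *)
Lemma X_fg_projective (E : lmodType (torus_fun R)) (V : set E) q a :
  (0 < q)%N -> module_iso V (X q a : set (fun2 R)) -> fg_projective V.
Proof.
move=> q0 VX; have [sV _ _] := VX.
have sX := submodule_X (- a) q0.
apply: (@fg_projective_summand _ _ V (X q (- a)) (q + q)) => //.
apply: module_iso_trans (module_iso_prod VX (module_iso_refl sX)) _.
apply: (module_iso_trans (X_add _ _ q0 q0)).
by rewrite subrr; apply: X_free; rewrite addn_gt0 q0.
Qed.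

End Classification.

(** * The multi-resolution analysis *)

Section Scaling.
Variable R : realType.
Implicit Types (f g xi : fun2 R) (s t : R) (k l : nat) (b : int).
Implicit Types u w : R -> R[i].

Definition sigma k l : fun2 R := fun x =>
  (phi (x 0 0 / k%:R) * phi (x 1 0 / l%:R))%:C.

Definition bumped k l (U : set (fun2 R)) : set (fun2 R) :=
  (fun f => f * sigma k l) @` U.

Lemma fun2ME f g x : (f * g) x = f x * g x. Proof. by []. Qed.

Lemma div_norm_le s k (r : R) : (0 < k)%N ->
  (`|s / k%:R| <= r) = (`|s| <= r * k%:R).
Proof.
by move=> k0; rewrite normrM normfV normr_nat ler_pdivrMr // ltr0n.
Qed.

Lemma div_norm_ge s k (r : R) : (0 < k)%N ->
  (r <= `|s / k%:R|) = (r * k%:R <= `|s|).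
Proof.
by move=> k0; rewrite normrM normfV normr_nat ler_pdivlMr // ltr0n.
Qed.

Lemma sigma_neq0 k l s t : (0 < k)%N -> (0 < l)%N ->
  `|s| <= 2^-1 * k%:R -> `|t| <= 2^-1 * l%:R -> sigma k l (pt s t) != 0.
Proof.
move=> k0 l0 hs ht; rewrite /sigma pt0 pt1 /= eq_complex /= eqxx andbT.
by rewrite mulf_neq0 // phi_neq0 // div_norm_le.
Qed.

Lemma sigma_eq1 k l s t : (0 < k)%N -> (0 < l)%N ->
  `|s| <= 3^-1 * k%:R -> `|t| <= 3^-1 * l%:R -> sigma k l (pt s t) = 1.
Proof.
by move=> k0 l0 hs ht; rewrite /sigma pt0 pt1 !phi_eq1 ?div_norm_le // mulr1.
Qed.

Lemma sigma_neq0_lt k l x : (0 < k)%N -> (0 < l)%N -> sigma k l x != 0 ->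
  `|x 0 0| < 2 / 3 * k%:R /\ `|x 1 0| < 2 / 3 * l%:R.
Proof.
move=> k0 l0 nz; split; rewrite ltNge; apply: contraNN nz => h.
  by rewrite /sigma phi_eq0 ?mul0r // div_norm_ge.
by rewrite /sigma [X in _ * X]phi_eq0 ?mulr0 // div_norm_ge.
Qed.

Lemma continuous_sigma k l : continuous (sigma k l).
Proof.
apply: continuous_real_complex; apply: continuousMr; apply: continuous_phi;
  by apply: continuousMr; [exact: continuous_coord|exact: continuous_cst].
Qed.

Lemma window_sym s k : (0 < k)%N -> exists (n : int) s',
  `|s'| <= 2^-1 * k%:R /\ s = s' - n%:~R * k%:R.
Proof.
move=> k0; have [n [s' [/andP[h1 h2] ->]]] := window (- (2^-1 * k%:R)) k0 s.
by exists n, s'; split=> //; rewrite ler_norml h1 /=; lra.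
Qed.

(** [sigma] vanishes nowhere on the closed fundamental domain centred at 0, and the values there
    determine [f]. *)
Lemma Z_sigma_eq0 k w l u f : (0 < k)%N -> (0 < l)%N ->
  (forall t, w t != 0) -> (forall s, u s != 0) ->
  Z k w l u f -> f * sigma k l = 0 -> f = 0.
Proof.
move=> k0 l0 w0 u0 Zf fs; apply: fun2P => s t.
have [n [s' [hs ->]]] := window_sym s k0.
have [m [t' [ht ->]]] := window_sym t l0.
rewrite (Z_shift w0 Zf); have [_ _ ft] := Zf.
rewrite (quasi_shift (u0 s') (ft s')).
have : (f * sigma k l) (pt s' t') = 0 by rewrite fs.
move=> /eqP; rewrite fun2ME mulf_eq0 => /orP[/eqP->|]; first by rewrite !mulr0.
by rewrite (negbTE (sigma_neq0 k0 l0 hs ht)).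
Qed.

Lemma sigma_iso k w l u U : (0 < k)%N -> (0 < l)%N ->
  (forall t, w t != 0) -> (forall s, u s != 0) ->
  submodule U -> U `<=` Z k w l u -> module_iso (bumped k l U) U.
Proof.
move=> k0 l0 w0 u0 sU UZ; apply: module_iso_sym.
have [U0 UD] := (submoduleP U).1 sU.
have lin a f g : (a *: f + g) * sigma k l = a *: (f * sigma k l) + g * sigma k l.
  by apply/funext => x; rewrite !fun2ME !fun2DE !fun2ZE fun2ME mulrDl mulrA.
apply: (@module_iso_lker _ _ _ _ _ (fun f => f * sigma k l)) => //.
- apply/submoduleP; split; first by exists 0 => //; rewrite mul0r.
  move=> a _ _ [f Uf <-] [g Ug <-]; exists (a *: f + g); first exact: UD.
  exact: lin.
- by move=> f Uf; exists f.
- by move=> f Uf; exact: (Z_sigma_eq0 k0 l0 w0 u0 (UZ _ Uf)).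
Qed.

Lemma norm_coord (x : 'cV[R]_2) i : `|x i 0| <= `|x|.
Proof.
rewrite {2}/Num.norm /= mx_normrE.
by apply: (le_trans _ (le_bigmax _ _ (i, 0))).
Qed.

Lemma CcP xi : Cc xi <-> continuous xi /\
  exists B : R, forall x, xi x != 0 -> `|x 0 0| <= B /\ `|x 1 0| <= B.
Proof.
split=> [[cxi comp]|[cxi [B HB]]]; split=> //.
  have [B [_ HB]] := compact_bounded comp.
  exists (B + 1) => x nz.
  have xB : `|x| <= B + 1.
    by apply: (HB (B + 1)); [rewrite ltrDl|exact: subset_closure].
  by split; apply: le_trans xB; exact: norm_coord.
(* The support lies in a square, obtained through [tr] as the image of a compact product of
   segments. *)
pose bx := [set v : 'rV[R]_2 | forall i, `[-B, B]%classic (v ord0 i)].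
have cb : compact bx.
  apply: (@rV_compact _ _ (fun=> `[-B, B]%classic)) => _.
  exact: segment_compact.
pose tr (v : 'rV[R]_2) := pt (v 0 0) (v 0 1).
have ctr : continuous tr by apply: continuous_pt; exact: coord_continuous.
have cimg : compact (tr @` bx).
  by apply: continuous_compact => //; exact: continuous_subspaceT.
apply: (subclosed_compact _ cimg); first exact: closed_closure.
have cl : closed (tr @` bx) by exact: compact_closed cimg.
rewrite [X in _ `<=` X](_ : _ = closure (tr @` bx)); last exact/closure_id.
apply: closure_subset => x /HB[h0 h1].
exists (\row_i x i 0); last by rewrite /tr !mxE -pt_eta.
move=> i; rewrite /= mxE in_itv /= -ler_norml.
case: i => [[|[|//]] hi].
  by rewrite (_ : Ordinal hi = 0 :> 'I_2) //; exact: val_inj.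
by rewrite (_ : Ordinal hi = 1 :> 'I_2) //; exact: val_inj.
Qed.

Lemma bumped_Cc k l w u U : (0 < k)%N -> (0 < l)%N ->
  U `<=` Z k w l u -> bumped k l U `<=` Cc (R := R).
Proof.
move=> k0 l0 UZ _ [f /UZ[cf _ _] <-]; apply/CcP; split.
  exact: (continuousM2 cf (@continuous_sigma k l)).
exists (2 / 3 * (k%:R + l%:R)) => x; rewrite fun2ME mulf_eq0 negb_or => /andP[_].
move=> /(sigma_neq0_lt k0 l0)[hs ht].
have kp : 0 <= k%:R :> R by []; have lp : 0 <= l%:R :> R by [].
by split; lra.
Qed.

(** The support of [sigma] exceeds the window. Where [k / 2 <= |s| < 2 k / 3], the extension takes
    its value from a translate at distance more than [k / 3] from 0, and [F] vanishes there. *)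
Lemma ext_support k w (F : fun2 R) : (0 < k)%N -> (forall t, w t != 0) ->
  (forall s t, 3^-1 * k%:R < `|s| -> F (pt s t) = 0) ->
  forall s t, `|s| < 2 / 3 * k%:R ->
    ext (- (2^-1 * k%:R)) k w F (pt s t) = F (pt s t).
Proof.
move=> k0 w0 F0 s t; have kp : 0 < k%:R :> R by rewrite ltr0n.
rewrite ltr_norml => /andP[h1 h2].
have [lo|lo] := ltrP s (- (2^-1 * k%:R)).
  rewrite F0; last by rewrite ltr0_norm; lra.
  rewrite -[s](addrK k%:R) ext_shift // ext_window //; last by lra.
  by rewrite F0 ?mulr0 // gtr0_norm; lra.
have [hi|hi] := ltrP s (2^-1 * k%:R); first by rewrite ext_window //; lra.
rewrite [RHS]F0; last by rewrite gtr0_norm; lra.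
apply: (mulfI (w0 t)); rewrite -ext_shift // ext_window //; last by lra.
by rewrite F0 ?mulr0 // ltr0_norm; lra.
Qed.

(* Extend [xi] quasi-periodically; [sigma] removes the other translates. *)
Lemma bumped_support k l u xi : (0 < k)%N -> (0 < l)%N -> multiplier k u ->
  continuous xi ->
  (forall s t, xi (pt s t) != 0 -> `|s| <= 3^-1 * k%:R /\ `|t| <= 3^-1 * l%:R) ->
  bumped k l (Z k (fun=> 1) l u) xi.
Proof.
move=> k0 l0 mu cxi supp; have [cu u0 pu] := mu.
have kp : 0 < k%:R :> R by rewrite ltr0n.
have lp : 0 < l%:R :> R by rewrite ltr0n.
have xi0s s t : 3^-1 * k%:R < `|s| -> xi (pt s t) = 0.
  move=> hs; apply/eqP; apply: contraTT hs => /supp[hs _].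
  by rewrite -leNgt.
have xi0t s t : 3^-1 * l%:R < `|t| -> xi (pt s t) = 0.
  move=> ht; apply/eqP; apply: contraTT ht => /supp[_ ht].
  by rewrite -leNgt.
have half (c : R) : 0 < c -> 3^-1 * c < `|- (2^-1 * c)|.
  by move=> ?; rewrite normrN gtr0_norm; lra.
have half' (c : R) : 0 < c -> 3^-1 * c < `|- (2^-1 * c) + c|.
  by move=> ?; rewrite gtr0_norm; lra.
pose F1 : fun2 R := ext (- (2^-1 * k%:R)) k (fun=> 1) xi.
have m1 n : multiplier n (fun _ : R => 1 : R[i]).
  exact: multiplier_cst (oner_neq0 _).
(* With the period 0 the relation in [t] is vacuous; the second extension [F] imposes the actual
   one. *)
have ZF1 : Z k (fun=> 1) 0 (fun=> 1) F1.
  apply: (Z_ext k0 (m1 0%N) cxi).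
  - by [].
  - by move=> t; rewrite mul1r !xi0s //; [exact: half'|exact: half].
  - by move=> s t _; rewrite subr0 mul1r.
have [cF1 F1s _] := ZF1.
have F1t s t : 3^-1 * l%:R < `|t| -> F1 (pt s t) = 0.
  by move=> ht; rewrite /F1 /ext xi0t ?mulr0 // pt1.
pose F := ext (- (2^-1 * l%:R)) l u (pull swap F1).
have ZF : Z l u k (fun=> 1) F.
  apply: (Z_ext l0 mu (continuous_pull (J := swap) cF1)).
  - by [].
  - by move=> t; rewrite !pull_swap !F1t ?mulr0 //; [exact: half'|exact: half].
  - by move=> s t _; rewrite !pull_swap F1s.
have ZFs : Z k (fun=> 1) l u (pull swap F).
  by rewrite -pull_swap_Z; exists F.
exists (pull swap F) => //; apply: fun2P => s t.
rewrite fun2ME pull_swap; have [sg0|sg0] := eqVneq (sigma k l (pt s t)) 0.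
  rewrite sg0 mulr0; apply/esym/eqP.
  have [//|/supp[hs ht]] := eqVneq (xi (pt s t)) 0.
  by move: sg0; rewrite sigma_eq1 // => /eqP; rewrite oner_eq0.
have [] := sigma_neq0_lt k0 l0 sg0; rewrite pt0 pt1 => hs ht.
rewrite /F ext_support //; last by move=> t' s' /F1t; rewrite pull_swap.
rewrite pull_swap /F1 ext_support // ?oner_neq0 //.
have [->|/supp[hs' ht']] := eqVneq (xi (pt s t)) 0; first by rewrite mul0r.
by rewrite sigma_eq1 // mulr1.
Qed.

End Scaling.

(** * Dilation by a diagonal matrix *)

Section Dilation.
Variable R : realType.
Implicit Types (f g xi : fun2 R) (s t : R) (k l m : nat) (b : int).

(* A loop of degree [b] that differs from [1] only near the multiples of [k];
   for [m = k = `|d1|] it is [1] on [1/3 <= s <= k - 1/3]. *)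
Definition twist m k b (s : R) : R[i] := e (b%:~R * Theta m%:R (s / k%:R)).

Lemma multiplier_twist m k b : (0 < m)%N -> (0 < k)%N -> multiplier k (twist m k b).
Proof.
move=> m0 k0; have m1 : 1 <= m%:R :> R by rewrite ler1n.
have kn0 : k%:R != 0 :> R by rewrite pnatr_eq0 -lt0n.
apply: (@multiplier_e R k b).
  apply: continuousMr; first exact: continuous_cst.
  apply: (continuous_Theta m1); apply: continuousMr; last exact: continuous_cst.
  by move=> s; exact: cvg_id.
by move=> s; rewrite mulrBl divff // ThetaB1 // mulrBr mulr1.
Qed.

Lemma twist_neq0 m k b s : twist m k b s != 0.
Proof. exact: e_neq0. Qed.

(** Reflection replaces [Theta] by [1 - Theta], and the constant adds the integer [b] to the
    phase. *)
Lemma twist_sign m k b (sg : int) s : (0 < m)%N -> sg = 1 \/ sg = -1 ->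
  twist m k b (sg%:~R * s) = twist m k (sg * b) s.
Proof.
move=> m0; have m1 : 1 <= m%:R :> R by rewrite ler1n.
move=> [->|->]; first by rewrite !mul1r.
rewrite /twist (_ : (-1)%:~R = -1 :> R) // !mulN1r mulNr ThetaN //.
by apply: (eB_int (n := b)); rewrite mulrNz; ring.
Qed.

Variables (d1 d2 : int).
Hypotheses (d10 : d1 != 0) (d20 : d2 != 0).

Let sgz1 (d : int) : d != 0 -> sgz d = 1 \/ sgz d = -1.
Proof. by move=> d0; rewrite /sgz (negbTE d0); case: ifP; [right|left]. Qed.

Let sg2 (d : int) : d != 0 -> sgz d * sgz d = 1.
Proof. by move=> /sgz1[] ->. Qed.

Let dE (d : int) : d%:~R = (sgz d)%:~R * `|d|%N%:R :> R.
Proof. by rewrite [in LHS](intEsg d) intrM. Qed.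

Let sgzR (d : int) : d != 0 -> (sgz d)%:~R ^+ 2 = 1 :> R.
Proof. by move=> /sg2 sd; rewrite expr2 -intrM sd. Qed.

Let absn0 (d : int) : d != 0 -> `|d|%N%:R != 0 :> R.
Proof. by move=> d0; rewrite pnatr_eq0 absz_eq0. Qed.

Let divE (d : int) s : d != 0 ->
  s / d%:~R = (sgz d)%:~R * (s / `|d|%N%:R).
Proof.
move=> d0; rewrite (dE d); case: (sgz1 d0) => ->; first by rewrite !mul1r.
by rewrite -[(-1)%:~R]/(-1) !mulN1r invrN mulrN.
Qed.

Definition diag2 : 'M[int]_2 := diag_mx (\row_i (if i == 0 then d1 else d2)).

Lemma det_diag2 : \det diag2 = d1 * d2.
Proof. by rewrite det_mx2 !mxE /= mulr0n mul0r subr0 !mulr1n. Qed.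

Lemma invmx_diag2 (x : 'cV[R]_2) :
  invmx (map_mx intr diag2)^T *m x = pt (x 0 0 / d1%:~R) (x 1 0 / d2%:~R).
Proof.
have un : (map_mx intr diag2 : 'M[R]_2)^T \in unitmx.
  by rewrite unitmx_tr unitmxE det_map_mx det_diag2 unitfE intr_eq0 mulf_neq0.
apply: (canLR (mulKmx un)); rewrite mulmx_pt !pt0 !pt1 !mxE /=.
rewrite !mulr0n !mulr1n !mul0r addr0 add0r !mulrA.
by rewrite ![_%:~R * _]mulrC !mulfK ?intr_eq0 // -pt_eta.
Qed.

Let c : R[i] := ((Num.sqrt `|\det (map_mx intr diag2 : 'M[R]_2)|)^-1)%:C.

Let cn0 : c != 0.
Proof.
rewrite /c eq_complex /= eqxx andbT invr_eq0 sqrtr_eq0 -ltNge normr_gt0.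
by rewrite det_map_mx det_diag2 intr_eq0 mulf_neq0.
Qed.

Lemma Dprime_diag2 xi x : Dprime (map_mx intr diag2) xi x =
  c * xi (pt (x 0 0 / d1%:~R) (x 1 0 / d2%:~R)).
Proof. by rewrite /Dprime invmx_diag2. Qed.

Lemma sigma_dilation k l (x : 'cV[R]_2) :
  sigma k l (pt (x 0 0 / d1%:~R) (x 1 0 / d2%:~R)) =
  sigma (`|d1| * k) (`|d2| * l) x.
Proof.
rewrite /sigma pt0 pt1.
have E d k' (s : R) : d != 0 -> phi (s / d%:~R / k'%:R) = phi (s / (`|d| * k')%N%:R).
  move=> d0; rewrite -[LHS]phi_norm -[RHS]phi_norm !normrM !normfV natrM normrM.
  by rewrite !normr_nat -intr_norm -natr_absz -mulrA -invfM.
by rewrite !E.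
Qed.

(** A negative [d1] reflects [s] and a negative [d2] inverts the relation in [t]; either changes the
    sign of the degree. The parameter [m] persists, as [twist] sees [s] only through [s / k]. *)
Lemma Dprime_bumped m k l b : (0 < m)%N -> (0 < k)%N -> (0 < l)%N ->
  Dprime (map_mx intr diag2) @` bumped k l (Z k (fun=> 1) l (twist m k b)) =
  bumped (`|d1| * k) (`|d2| * l) (Z (`|d1| * k) (fun=> 1) (`|d2| * l)
    (twist m (`|d1| * k) (sgz (d1 * d2) * b))).
Proof.
move=> m0 k0 l0; rewrite sgzM.
have kn0 : k%:R != 0 :> R by rewrite pnatr_eq0 -lt0n.
apply/seteqP; split=> [_ [_ [f Zf <-] <-]|_ [g Zg <-]].
  pose F : fun2 R := fun x => c * f (pt (x 0 0 / d1%:~R) (x 1 0 / d2%:~R)).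
  exists F; last first.
    apply/funext => x; rewrite Dprime_diag2 !fun2ME sigma_dilation.
    by rewrite mulrA.
  have [cf fs ft] := Zf; split.
  - apply: continuousM2; first exact: continuous_cst.
    by apply: (continuous_fun2 cf); apply: continuousMr;
      (exact: continuous_coord || exact: continuous_cst).
  - move=> s t; rewrite /F !pt0 !pt1 mul1r; congr (_ * _).
    rewrite (_ : _ / _ = s / d1%:~R - (sgz d1)%:~R * k%:R).
      by rewrite (Z_shift (fun=> oner_neq0 _) Zf) exp1rz mul1r.
    rewrite mulrBl; congr (_ - _); rewrite divE // natrM.
    by congr (_ * _); rewrite mulrAC divff ?absn0 ?mul1r.
  - move=> s t; rewrite /F !pt0 !pt1.
    rewrite (_ : (t - _) / _ = t / d2%:~R - (sgz d2)%:~R * l%:R).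
      rewrite (quasi_shift (twist_neq0 _ _ _ _) (ft (s / d1%:~R))) mulrCA.
      congr (_ * _); rewrite divE // twist_sign; [|exact: m0|exact: sgz1].
      rewrite /twist eXz; congr e; rewrite natrM !intrM invfM.
      rewrite [(s / _) / _]mulrAC -[s / k%:R / _]mulrA.
      by rewrite [k%:R^-1 * _]mulrC -mulrA; ring.
    rewrite mulrBl; congr (_ - _); rewrite divE // natrM.
    by congr (_ * _); rewrite mulrAC divff ?absn0 ?mul1r.
pose f : fun2 R := fun x => c^-1 * g (pt (d1%:~R * x 0 0) (d2%:~R * x 1 0)).
have gE (x : 'cV[R]_2) : c * f (pt (x 0 0 / d1%:~R) (x 1 0 / d2%:~R)) = g x.
  rewrite /f pt0 pt1 mulVKf // !(mulrC _%:~R) !divfK ?intr_eq0 //.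
  by rewrite -pt_eta.
exists (f * sigma k l); last first.
  apply/funext => x; rewrite Dprime_diag2 !fun2ME sigma_dilation.
  by rewrite mulrA gE.
exists f => //; have [cg gs gt] := Zg; split.
- apply: continuousM2; first exact: continuous_cst.
  by apply: (continuous_fun2 cg); apply: continuousMr;
    (exact: continuous_coord || exact: continuous_cst).
- move=> s t; rewrite /f !pt0 !pt1 mul1r; congr (_ * _).
  rewrite mulrBr [d1%:~R in X in _ - X]dE -mulrA -natrM.
  by rewrite (Z_shift (fun=> oner_neq0 _) Zg) exp1rz mul1r.
- move=> s t; rewrite /f !pt0 !pt1.
  rewrite mulrBr [d2%:~R in X in _ - X]dE -mulrA -natrM.
  rewrite (quasi_shift (twist_neq0 _ _ _ _) (gt (d1%:~R * s))) mulrCA.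
  congr (_ * _).
  have -> : d1%:~R * s = (sgz d1)%:~R * (`|d1|%N%:R * s).
    by rewrite [in LHS](dE d1) mulrA.
  rewrite twist_sign; [|exact: m0|exact: sgz1].
  rewrite /twist eXz natrM; congr e; rewrite !intrM.
  rewrite (_ : _ * s / _ = s / k%:R); last first.
    by rewrite -mulf_div divff ?mul1r // absn0.
  transitivity ((sgz d1)%:~R ^+ 2 * (sgz d2)%:~R ^+ 2 *
    (b%:~R * Theta m%:R (s / k%:R))); first by ring.
  by rewrite !sgzR // !mul1r.
Qed.

Lemma ladder_diag2 m q a i : (0 < m)%N -> (0 < q)%N ->
  ladder (map_mx intr diag2) (bumped 1 q (Z 1 (fun=> 1) q (twist m 1 a))) i =
  bumped (`|d1| ^ i) (`|d2| ^ i * q)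
    (Z (`|d1| ^ i) (fun=> 1) (`|d2| ^ i * q)
       (twist m (`|d1| ^ i) (sgz (d1 * d2) ^+ i * a))).
Proof.
move=> m0 q0; elim: i => [|i IHi]; first by rewrite /ladder /= !expn0 mul1n mul1r.
rewrite /ladder iterS -/(ladder _ _ i) IHi Dprime_bumped //.
- by rewrite !expnS mulnA exprS mulrA.
- by rewrite expn_gt0 lt0n absz_eq0 d10.
- by rewrite muln_gt0 expn_gt0 lt0n absz_eq0 d20.
Qed.

End Dilation.

(** * Lattice sums with finite support *)

Section FiniteSums.
Variable R : realType.
Implicit Types (f g xi eta : fun2 R) (p : 'cV[int]_2).

Lemma sum_finite (I : choiceType) (F : I -> R[i]^o) (r : seq I) : uniq r ->
  (forall i, i \notin r -> F i = 0) ->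
  summability.sum F = \sum_(i <- r) F i.
Proof.
move=> ur F0.
have Ft : ProperFilter (@summability.totally I) := summability.totally_filter.
apply: cvg_lim; first exact: norm_hausdorff.
(* The partial sums are constant from the finite set [r] on. *)
apply: cvg_near_cst; exists (finmap.seq_fset tt r) => // A /= rA.
rewrite /summability.partial_sum -(finmap.big_seq_fsetE _ _ predT) /=.
rewrite (bigID (mem r)) /= [X in _ + X]big1 ?addr0 //.
rewrite -big_filter; apply: perm_big; apply: uniq_perm => //.
  by rewrite filter_uniq // finmap.fset_uniq.
move=> i; rewrite mem_filter andb_idr // => ri.
have ir : i \in finmap.seq_fset tt r by rewrite finmap.seq_fsetE.
exact: (finmap.fsubsetP rA i ir).
Qed.

Definition pint (m n : int) : 'cV[int]_2 := \col_i (if i == 0 then m else n).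

Lemma pint0 m n : pint m n 0 0 = m. Proof. by rewrite mxE. Qed.
Lemma pint1 m n : pint m n 1 0 = n. Proof. by rewrite mxE. Qed.
Lemma pint_eta p : p = pint (p 0 0) (p 1 0).
Proof.
apply/colP => i; rewrite mxE.
by case: i => [[|[|//]] hi]; rewrite /=; congr (p _ _); exact: val_inj.
Qed.

Lemma finite_support xi x : Cc xi -> exists2 r, uniq r &
  forall p, p \notin r -> xi (x - intvec R p) = 0.
Proof.
move=> /CcP[_ [B HB]].
pose C : R := `|x 0 0| + `|x 1 0| + `|B|.
pose M := `|Num.ceil C|%N.
have CM : C <= M%:R.
  by rewrite natr_absz intr_norm; exact: le_trans (ceil_ge _) (ler_norm _).
pose L : seq int := [seq i%:Z - M%:Z | i <- iota 0 (M + M).+1].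
have LP (z : int) : `|z%:~R| <= M%:R :> R -> z \in L.
  move=> zM; have {}zM : (`|z| <= M)%N.
    by rewrite -(ler_nat R) natr_absz intr_norm.
  apply/mapP; exists (absz (z + M%:Z)); last by lia.
  by rewrite mem_iota; lia.
exists (undup [seq pint m n | m <- L, n <- L]); first exact: undup_uniq.
move=> p; rewrite mem_undup => pr; apply/eqP; apply: contraNT pr => /HB.
rewrite !mxE => -[h0 h1]; rewrite (pint_eta p); apply: allpairs_f; apply: LP;
  apply: le_trans CM; rewrite /C.
  have := ler_normD (x 0 0 - (p 0 0)%:~R) (- x 0 0).
  rewrite addrAC subrr add0r !normrN.
  have := ler_norm B; have := normr_ge0 (x 1 0); lra.
have := ler_normD (x 1 0 - (p 1 0)%:~R) (- x 1 0).
rewrite addrAC subrr add0r !normrN.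
have := ler_norm B; have := normr_ge0 (x 0 0); lra.
Qed.

(** An automorphism of the lattice permutes the terms, and compact support makes both series finite
    sums. *)
Lemma inner_pull (J J' : 'M[int]_2) xi eta x : J *m J' = 1%:M ->
  J' *m J = 1%:M -> Cc xi ->
  inner (pull J xi) (pull J eta) x = inner xi eta (map_mx intr J *m x).
Proof.
move=> JJ' J'J /(finite_support (map_mx intr J *m x))[r ur r0].
rewrite /inner; have E p : map_mx intr J *m (x - intvec R p) =
    map_mx intr J *m x - intvec R (J *m p) by rewrite mulmxBr /intvec map_mxM.
have G0 p : p \notin r -> Num.conj (xi (map_mx intr J *m x - intvec R p)) *
    eta (map_mx intr J *m x - intvec R p) = 0.
  by move=> /r0 ->; rewrite rmorph0 mul0r.
rewrite (sum_finite ur G0).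
have inj : injective (mulmx J' : 'cV[int]_2 -> 'cV[int]_2).
  by apply: (can_inj (g := mulmx J)) => p; rewrite mulmxA JJ' mul1mx.
rewrite (@sum_finite _ _ [seq J' *m p | p <- r]).
- rewrite big_map; apply: eq_bigr => p _.
  by rewrite /pull E mulmxA JJ' mul1mx.
- by rewrite map_inj_uniq.
- move=> p; rewrite /pull E => pr; apply: G0; apply: contraNN pr => pr.
  by apply/mapP; exists (J *m p) => //; rewrite mulmxA J'J mul1mx.
Qed.

End FiniteSums.

(** * The orthogonal complement *)

Section Complement.
Variables (R : realType) (q d d' : nat) (a eps : int).
Hypothesis q0 : (0 < q)%N.
Implicit Types (f g h : fun2 R) (s t : R).

Let D := d.+2.
Let L := (d'.+2 * q)%N.
(** Dilations preserve the first argument of [twist], so the value [D] has to be fixed in [V_0]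
    already. In [V_1] the jump of [u3] then has half-width 1/3 in [s], the radius on which [phi] is
    1. *)
Let u0 : R -> R[i] := twist D 1 a.
Let u1 : R -> R[i] := twist 1 1 (eps * a).
Let u3 : R -> R[i] := twist D D (eps * a).

(* The fibrewise adjoint of the inclusion of [V_0] in [V_1] is the composite of
   a cut along [s] and a cut along [t]. *)
Definition adjoint_embedding h : fun2 R :=
  pull swap (cut1 q u0 (pull swap (cut1 1 (fun=> 1) h))).

Let L0 : (0 < L)%N. Proof. by rewrite muln_gt0. Qed.

Let m1 n : multiplier n (fun _ : R => 1 : R[i]).
Proof. exact: multiplier_cst (oner_neq0 _). Qed.

Let phi_lt s : 0 <= s -> phi s != 0 -> s < 2 / 3.
Proof.
by move=> s0; rewrite ltNge; apply: contraNN => hs; rewrite phi_eq0 // ger0_norm.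
Qed.

Let psi_gt s : 0 <= s -> psi s != 0 -> 3^-1 < s.
Proof.
by move=> s0; rewrite ltNge; apply: contraNN => hs; rewrite psi_eq0 // ger0_norm.
Qed.

Let D1 : 1 <= D%:R :> R. Proof. by rewrite ler1n. Qed.
Let D2 : 2 <= D%:R :> R. Proof. by rewrite (ler_nat R 2). Qed.
Let Dn0 : D%:R != 0 :> R. Proof. by rewrite pnatr_eq0. Qed.

Let mulD s : D%:R * (s / D%:R) = s.
Proof. by rewrite mulrC divfK. Qed.

(* [u1] is the multiplier of the intermediate module between the two cuts. *)
Let u1_u3 s : `|s| <= 2 / 3 -> u1 s = u3 s.
Proof.
by move=> hs; rewrite /u1 /u3 /twist divr1 [in RHS]Theta_rescale // mulD.
Qed.

Let u3_eq1 s : 3^-1 <= s <= D%:R - 3^-1 -> u3 s = 1.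
Proof.
move=> /andP[? ?]; rewrite /u3 /twist Theta_const ?mulD // mulr1.
by rewrite e_int.
Qed.

Let u3_eq1N s : 3^-1 <= - s <= D%:R - 3^-1 -> u3 s = 1.
Proof.
move=> /andP[? ?]; rewrite /u3 /twist -[s / _]opprK ThetaN // -mulNr.
by rewrite Theta_const ?mulD // subrr mulr0 e0.
Qed.

(** The phase of the multiplier that the cut along [t] leaves over when [u0] is split off from [u1].
    The summand 1/2 supplies the sign that a cut demands. *)
Let chi s : R := 2^-1 + (eps * a)%:~R * Theta 1 s - a%:~R * Theta D%:R s.

Let continuous_chi : continuous chi.
Proof.
have cT m : 1 <= m -> continuous (fun s : R => Theta m s).
  by move=> m1'; apply: (continuous_Theta m1') => s; exact: cvg_id.
apply: continuousBr; last first.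
  by apply: continuousMr; [exact: continuous_cst|exact: cT].
apply: continuousDr; first exact: continuous_cst.
by apply: continuousMr; [exact: continuous_cst|exact: cT].
Qed.

Let chi_shift s : chi (s - 1) = chi s - ((eps - 1) * a)%:~R.
Proof. by rewrite /chi !ThetaB1 // !intrM intrB; ring. Qed.

Let u1E s : u1 s = - (u0 s * e (chi s)).
Proof.
rewrite -[RHS]mulN1r -(e_half R) /u1 /u0 /twist divr1 -!eD /chi.
apply/esym/(eB_int (n := 1)); lra.
Qed.

Definition kernel_t : set (fun2 R) := pull swap @`
  [set g | Z L u1 1 (fun=> 1) g /\ [set 0] (cut1 q u0 g)].

Lemma kernel_t_iso :
  module_iso kernel_t (N 1 (d'.+1 * q) ((eps - 1) * a) : set (fun2 R)).
Proof.
have s0 : submodule ([set 0] : set (fun2 R)).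
  by apply/submoduleP; split=> // h f g /= -> ->; rewrite scaler0 addr0.
have k20 : (0 < d'.+1 * q)%N by rewrite muln_gt0.
have iso0 : module_iso [set g | Z L u1 1 (fun=> 1) g /\ [set 0] (cut1 q u0 g)]
    ([set 0 : fun2 R] `*` Z (d'.+1 * q) (fun s => e (chi s)) 1 (fun=> 1)).
  have mchi : multiplier 1 (fun s => e (chi s)) :=
    @multiplier_e R 1 ((eps - 1) * a) chi continuous_chi chi_shift.
  have mu0 : multiplier 1 u0 := @multiplier_twist R D 1 a (ltn0Sn d.+1) (ltn0Sn 0).
  have sub0 : [set 0] `<=` Z q u0 1 (fun _ : R => 1).
    by move=> f ->; have /submoduleP[] := submodule_Z q u0 1 (fun _ : R => 1).
  have := @cut_iso R q (d'.+1 * q) 1 u0 (fun s => e (chi s)) u1 (fun=> 1)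
    (fun=> 1) (fun=> 1) q0 (leq_pmull q (ltn0Sn d'))
    mu0 mchi u1E.
  (* The lengths [q] and [d'.+1 * q] add up to [L]. *)
  rewrite -mulSn => H.
  by apply: (H _ _ _ _ _ _ _ [set 0] s0 sub0).
have [_ sZ _] := iso0.
have iso1 : module_iso
    ([set 0 : fun2 R] `*` Z (d'.+1 * q) (fun s => e (chi s)) 1 (fun=> 1))
    (Z (d'.+1 * q) (fun s => e (chi s)) 1 (fun=> 1)).
  apply/module_isoP; split=> //; first exact: submodule_Z.
  exists snd, (pair 0); split=> //.
  - by move=> f [].
  - by move=> [f g] [/= -> _].
apply: (module_iso_trans (module_iso_pull (@swapK) (@swapK)
  (module_iso_trans iso0 iso1))).
rewrite pull_swap_Z; apply: (Z_degree k20 continuous_chi).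
exact: chi_shift.
Qed.

(** This and the next three are the agreement conditions for cutting the circle of length [D] into
    lengths 1 and [D - 1], with multipliers [u1] and 1. As [phi] requires [s < 2/3] and [psi]
    requires [s > 1/3], each argument of [u3] lies either within 2/3 of 0, where [u3] is [u1], or
    where [u3] is 1. *)
Let cond1 s : 0 <= s <= 1 -> (phi (s / 1))%:C != 0 -> u1 s = u3 s.
Proof.
rewrite divr1 => /andP[s0 s1] nz; apply: u1_u3; rewrite ger0_norm // ltW //.
by apply: phi_lt => //; apply: contraNneq nz => ->.
Qed.

Let cond2 s : 0 <= s <= 1 -> (phi (s / 1))%:C != 0 -> 1 = u3 (s - 1).
Proof.
rewrite divr1 => /andP[s0 s1] nz; rewrite u3_eq1N //.
have : s < 2 / 3 by apply: phi_lt => //; apply: contraNneq nz => ->.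
by have := D2; lra.
Qed.

Let cond3 s : 0 <= s <= 1 -> (psi (s / 1))%:C != 0 -> u1 s = u3 (s - 1).
Proof.
rewrite divr1 => /andP[s0 s1] nz; rewrite -u1_u3; last first.
  have : 3^-1 < s by apply: psi_gt => //; apply: contraNneq nz => ->.
  by rewrite ler_norml; lra.
have [_ _ pu1] := multiplier_twist R (eps * a) (ltn0Sn 0) (ltn0Sn 0).
by rewrite /u1 pu1.
Qed.

Let cond4 s : 0 <= s <= d.+1%:R -> (psi (s / 1))%:C != 0 -> 1 = u3 s.
Proof.
rewrite divr1 => /andP[s0 s1] nz; rewrite u3_eq1 //.
have : 3^-1 < s by apply: psi_gt => //; apply: contraNneq nz => ->.
by rewrite /D -[d.+2]addn1 natrD; lra.
Qed.

Lemma Z_cut1_u h : Z D (fun=> 1) L u3 h -> Z 1 (fun=> 1) L u1 (cut1 1 (fun=> 1) h).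
Proof.
have [_ _ pu1] := multiplier_twist R (eps * a) (ltn0Sn 0) (ltn0Sn 0).
exact: (@Z_cut1 R 1 d.+1 L _ _ _ _ (ltn0Sn 0) (m1 L) pu1 cond1 cond3).
Qed.

(** Two remainders survive: an untwisted one of periods [D - 1] and [L] from the cut along [s], and
    one of periods 1 and [L - q] carrying the whole degree from the cut along [t]. Their ranks add
    up to [D * L - q]. *)
Lemma kernel_iso : module_iso
  [set h | Z D (fun=> 1) L u3 h /\ adjoint_embedding h = 0]
  (X ((D * d'.+2 - 1) * q) ((eps - 1) * a) : set (fun2 R)).
Proof.
have [sK _ _] := kernel_t_iso.
have [_ _ pu3] := multiplier_twist R (eps * a) (ltn0Sn d.+1) (ltn0Sn d.+1).
have [_ _ pu1] := multiplier_twist R (eps * a) (ltn0Sn 0) (ltn0Sn 0).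
have k20 : (0 < d'.+1 * q)%N by rewrite muln_gt0.
have KZ : kernel_t `<=` Z 1 (fun=> 1) L u1.
  by move=> _ [g [Zg _] <-]; rewrite -pull_swap_Z; exists g.
have -> : [set h | Z D (fun=> 1) L u3 h /\ adjoint_embedding h = 0] =
    [set h | Z (1 + d.+1) (fun=> 1) L u3 h /\ kernel_t (cut1 1 (fun=> 1) h)].
  apply/seteqP; split=> h [Zh hP]; split=> //.
    exists (pull swap (cut1 1 (fun=> 1) h)); last exact: (pullK swapK).
    split.
      rewrite -pull_swap_Z; exists (cut1 1 (fun=> 1) h) => //.
      exact: Z_cut1_u.
    by rewrite /= -[LHS](pullK swapK) -/(adjoint_embedding h) hP.
  have [g [_ g0] gh] := hP.
  by rewrite /adjoint_embedding -gh (pullK swapK) g0.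
(* The multiplier [-1] of the second piece cancels the gluing sign, so that the uncut module has
   multiplier 1. *)
apply: (@module_iso_trans _ _ _ _ _ (kernel_t `*` Z d.+1 (fun=> -1) L (fun=> 1))).
  apply: (cut_iso (w1 := fun=> 1) (w2 := fun=> -1) (u1 := u1) (u2 := fun=> 1)) => //.
  - by apply: multiplierN; exact: m1.
  - by move=> t; rewrite mul1r opprK.
have NE : Z d.+1 (fun _ : R => 1) L (fun=> 1) = N d.+1 L 0.
  rewrite /N; congr (Z _ _ _ _); apply/funext => t.
  rewrite (_ : (0 : int)%:~R = 0 :> R) //.
  by rewrite oppr0 !mul0r e0.
apply: (module_iso_trans (module_iso_prod kernel_t_iso (Z_sign _ _ _ (ltn0Sn d)))).
rewrite NE.
apply: (module_iso_trans (module_iso_prod (module_iso_refl (submodule_N _ _ _ _))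
  (N_flatten _ _ (ltn0Sn d) L0))).
have k30 : (0 < d.+1 * L)%N by rewrite muln_gt0.
apply: (module_iso_trans (module_iso_sym
  (N_addl R ((eps - 1) * a) 0 (ltn0Sn 0) k20 k30))).
rewrite addr0; have -> : (d'.+1 * q + d.+1 * L)%N = ((D * d'.+2 - 1) * q)%N.
  by rewrite /L /D mulnA -mulnDl; congr muln; lia.
by apply/module_iso_sym/X_N; rewrite muln_gt0 q0 andbT; lia.
Qed.

Let q0R : 0 < q%:R :> R. Proof. by rewrite ltr0n. Qed.

Let L_ge : 2 * q%:R <= L%:R :> R.
Proof. by rewrite -natrM ler_nat leq_mul2r orbT. Qed.

Let sigma_absorb (x : 'cV[R]_2) : sigma 1 q x * sigma D L x = sigma 1 q x.
Proof.
have [->|sg0] := eqVneq (sigma 1 q x) 0; first by rewrite mul0r.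
have [] := sigma_neq0_lt (ltn0Sn 0) q0 sg0; rewrite [x]pt_eta !pt0 !pt1 => hs ht.
rewrite [sigma D L _]sigma_eq1 ?mulr1 //; have := L_ge; have := D2; lra.
Qed.

Let conj_real (r : R) : Num.conj (r%:C : R[i]) = r%:C.
Proof. by rewrite /Num.conj /= oppr0. Qed.

Let inner_term f h (y : 'cV[R]_2) :
  Num.conj ((f * sigma 1 q) y) * (h * sigma D L) y =
  Num.conj (f y) * h y * sigma 1 q y.
Proof.
rewrite !fun2ME rmorphM /= [Num.conj (sigma 1 q y)]conj_real.
by rewrite -[in RHS]sigma_absorb; ring.
Qed.

(** [f] takes the same value at [s] and [s - 1], and [psi s = phi (s - 1)], so the two weighted
    values of [h] combine to the first component of a cut. *)
Let sum_s f h s t : Z 1 (fun=> 1) q u0 f -> 0 <= s < 1 ->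
  Num.conj (f (pt s t)) * h (pt s t) * sigma 1 q (pt s t) +
  Num.conj (f (pt (s - 1) t)) * h (pt (s - 1) t) * sigma 1 q (pt (s - 1) t) =
  Num.conj (f (pt s t)) * (phi (t / q%:R))%:C * cut1 1 (fun=> 1) h (pt s t).
Proof.
move=> [_ fs _] /andP[s0 s1]; rewrite fs mul1r cut1E //; last by rewrite s0.
rewrite /sigma !pt0 !pt1 !divr1 invr1 psiE ?s0 ?ltW // !rmorphM /=.
by ring.
Qed.

(** The support of [sigma 1 q] meets at most two translates in [s] and [2 q] in [t]. Terms at
    distance 1 in [s] merge into the first cut, those at distance [q] in [t] into the second, and a
    pairing over one period of [t] remains. *)
Lemma inner_adjoint f h s t (m n : int) : Z 1 (fun=> 1) q u0 f ->
  0 <= s < 1 -> 0 <= t < 1 ->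
  inner (f * sigma 1 q) (h * sigma D L) (pt (s + m%:~R) (t + n%:~R)) =
  \sum_(i <- iota 0 q)
     Num.conj (f (pt s (t + (q%:R - 1 - i%:R)))) *
     adjoint_embedding h (pt s (t + (q%:R - 1 - i%:R))).
Proof.
move=> Zf Hs Ht; have [_ fs ft] := Zf.
(* Subtracting [P j i] leads to [(s - j, t + q - 1 - i)]; for [i < 2 q] the second coordinate runs
   from [t + q - 1] down to [t - q]. *)
pose P (j i : nat) := pint (m + j%:Z) (n + (i%:Z - (q%:Z - 1))).
pose r := [seq P j i | j <- iota 0 2, i <- iota 0 (q + q)].
have xP j i : pt (s + m%:~R) (t + n%:~R) - intvec R (P j i) =
    pt (s - j%:R) (t + (q%:R - 1 - i%:R)).
  by rewrite ptB_intvec pint0 pint1 !(intrD, intrN, intrB); congr pt; ring.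
rewrite /inner (@sum_finite _ _ _ r).
- rewrite big_allpairs_dep exchange_big /=.
  under eq_bigr do rewrite !big_cons big_nil addr0 !xP !inner_term subr0 sum_s //.
  (* The indices [i] and [q + i] belong to points that differ by [q] in [t]. *)
  have -> : iota 0 (q + q) = iota 0 q ++ [seq (q + i)%N | i <- iota 0 q].
    by rewrite iotaD -iotaDl addn0 add0n.
  rewrite big_cat big_map /= -big_split /=.
  apply: eq_big_seq => i; rewrite mem_iota /= => iq.
  set tau := t + (q%:R - 1 - i%:R).
  have -> : t + (q%:R - 1 - (q + i)%:R) = tau - q%:R.
    by rewrite /tau natrD; ring.
  have Htau : 0 <= tau < q%:R.
    have : i.+1%:R <= q%:R :> R by rewrite ler_nat.
    have i0 : 0 <= i%:R :> R by [].
    by rewrite -addn1 natrD /tau; lra.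
  rewrite /adjoint_embedding pull_swap (cut1E u0 q0 _ s Htau) !pull_swap ft rmorphM /=.
  (* [u0] is unimodular, so the conjugate coming from [f] is the inverse that the cut applies to
     [h]. *)
  have -> : Num.conj (u0 s) = (u0 s)^-1 by rewrite /u0 /twist e_conj eV.
  rewrite psiE; last first.
    have [tau0 tauq] := andP Htau.
    by rewrite divr_ge0 ?ler_pdivrMr ?mul1r ?(ltW tauq).
  by rewrite mulrBl divff ?lt0r_neq0 //; ring.
- apply: allpairs_uniq; rewrite ?iota_uniq // => -[j i] [j' i'] _ _ /= E.
  have /= := congr1 (fun p : 'cV[int]_2 => p 0 0) E; rewrite !pint0.
  move=> /addrI[->].
  have /= := congr1 (fun p : 'cV[int]_2 => p 1 0) E; rewrite !pint1.
  by move=> /addrI/addIr[->].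
- move=> p; apply: contraNeq; rewrite inner_term mulf_eq0 negb_or => /andP[_].
  move=> /(sigma_neq0_lt (ltn0Sn 0) q0); rewrite ptB_intvec pt0 pt1 !ltr_norml.
  move=> [/andP[h1 h2] /andP[h3 h4]].
  have [s0 s1] := andP Hs; have [t0 t1] := andP Ht.
  have a1 : (m - 1)%:~R < (p 0 0)%:~R :> R by rewrite intrB; lra.
  have a2 : (p 0 0)%:~R < (m + 2)%:~R :> R by rewrite intrD; lra.
  have q1 : 1 <= q%:R :> R by rewrite ler1n.
  have a3 : (n - q%:Z)%:~R < (p 1 0)%:~R :> R.
    by rewrite intrB -[q%:~R]/(q%:R); lra.
  have a4 : (p 1 0)%:~R < (n + q%:Z + 1)%:~R :> R.
    by rewrite !intrD -[q%:~R]/(q%:R); lra.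
  rewrite !ltr_int in a1 a2 a3 a4.
  rewrite [p]pint_eta; apply/allpairsP.
  move: (p 0 0) (p 1 0) a1 a2 a3 a4 => x y a1 a2 a3 a4.
  exists (absz (x - m)%R, absz (y - n + (q%:Z - 1))%R).
  rewrite !mem_iota /P /=; clear -q0 a1 a2 a3 a4; split; [by lia|by lia|].
  by congr pint; lia.
Qed.

Lemma Z_adjoint h : Z D (fun=> 1) L u3 h ->
  Z 1 (fun=> 1) q u0 (adjoint_embedding h).
Proof.
move=> /Z_cut1_u Zf.
rewrite -(@pull_swap_Z R q u0 1 (fun=> 1)).
exists (cut1 q u0 (pull swap (cut1 1 (fun=> 1) h))) => //.
have Zg : Z L u1 1 (fun=> 1) (pull swap (cut1 1 (fun=> 1) h)).
  by rewrite -pull_swap_Z; exists (cut1 1 (fun=> 1) h).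
have mu0 : multiplier 1 u0 := @multiplier_twist R D 1 a (ltn0Sn d.+1) (ltn0Sn 0).
rewrite /L mulSn in Zg.
by apply: (Z_cut1 q0 mu0 _ _ _ Zg).
Qed.

Lemma orth_compl_bumped :
  orth_compl (bumped D L (Z D (fun=> 1) L u3)) (bumped 1 q (Z 1 (fun=> 1) q u0)) =
  bumped D L [set h | Z D (fun=> 1) L u3 h /\ adjoint_embedding h = 0].
Proof.
apply/seteqP; split=> [_ [[h Zh <-] orth]|_ [h [Zh h0] <-]]; last first.
  split; first by exists h.
  move=> _ [f Zf <-]; apply: fun2P => s t.
  have split_int (r : R) : exists (k : int) r', 0 <= r' < 1 /\ r = r' + k%:~R.
    exists (Num.floor r), (r - (Num.floor r)%:~R); split; last by rewrite subrK.
    have := real_floor_itv (num_real r); rewrite intrD => /andP[? ?].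
    by apply/andP; split; lra.
  have [m [s' [Hs ->]]] := split_int s; have [n [t' [Ht ->]]] := split_int t.
  by rewrite inner_adjoint // h0 big1 // => i _; rewrite mulr0.
exists h => //; split=> //; set f := adjoint_embedding h.
have Zf : Z 1 (fun=> 1) q u0 f by exact: Z_adjoint.
have Z0 : Z 1 (fun=> 1) q u0 0.
  by have /submoduleP[] := submodule_Z 1 (fun _ : R => 1) q u0.
apply: (Z_eq (a := 0) (ltn0Sn 0) (fun=> oner_neq0 _) Zf Z0) => s t.
rewrite add0r => Hs; have [n [tau [Htau ->]]] := window 0 q0 t.
have [_ _ ft] := Zf; rewrite (quasi_shift (twist_neq0 _ _ _ _) (ft s)).
rewrite add0r in Htau; have [tau0 tauq] := andP Htau.
have /andP[j1 j2] := truncn_itv tau0; set j := Num.truncn tau in j1 j2.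
have jq : (j < q)%N by rewrite -(ltr_nat R) (le_lt_trans j1).
have Ht : 0 <= tau - j%:R < 1.
  by move: j2; rewrite -addn1 natrD => j2; apply/andP; split; lra.
(* Tested against [f * sigma 1 q] itself, orthogonality says that a sum of squares of [|f|] over one
   period vanishes. *)
have := congr1 (fun g : fun2 R => g (pt (s + 0%:~R) (tau - j%:R + 0%:~R)))
  (orth _ (ex_intro2 _ _ f Zf erefl)).
rewrite inner_adjoint // => /eqP; rewrite -/f psumr_eq0; last first.
  by move=> i _; rewrite mulrC -normCK exprn_ge0.
(* The index [q - 1 - j] is the one whose point is [tau]. *)
have iq : (q.-1 - j < q)%N by rewrite (leq_ltn_trans (leq_subr _ _)) // ltn_predL.
have jq1 : (j <= q.-1)%N by rewrite -ltnS prednK.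
move=> /allP/(_ (q.-1 - j)%N); rewrite mem_iota /= add0n iq => /(_ isT).
rewrite (_ : _ + _ = tau); last first.
  by rewrite natrB // -subn1 natrB //; ring.
by rewrite mulf_eq0 conjC_eq0 orbb => /eqP ->; rewrite mulr0.
Qed.

End Complement.

(** * Nesting, change of coordinates and assembly *)

Section Assembly.
Variable R : realType.
Implicit Types (xi eta : fun2 R) (V : set (fun2 R)).

Lemma bumped_X m k l b : (0 < m)%N -> (0 < k)%N -> (0 < l)%N ->
  module_iso (bumped k l (Z k (fun=> 1) l (twist m k b)))
    (X (k * l) b : set (fun2 R)).
Proof.
move=> m0 k0 l0.
apply: (@module_iso_trans _ _ _ _ _ (Z k (fun=> 1) l (twist m k b))).
  apply: (@sigma_iso R k (fun=> 1) l (twist m k b)) => //.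
  - by move=> s; exact: twist_neq0.
  - exact: submodule_Z.
have m1 : 1 <= m%:R :> R by rewrite ler1n.
have kn0 : k%:R != 0 :> R by rewrite pnatr_eq0 -lt0n.
apply: (@module_iso_trans _ _ _ _ _ (N k l b)).
  apply: (@Z_degree R k l b (fun s => b%:~R * Theta m%:R (s / k%:R)) l0).
    apply: continuousMr; first exact: continuous_cst.
    apply: (continuous_Theta m1); apply: continuousMr; last exact: continuous_cst.
    by move=> s; exact: cvg_id.
  by move=> s; rewrite mulrBl divff // ThetaB1 // mulrBr mulr1.
apply: module_iso_trans (N_flatten _ _ k0 l0) _.
by apply/module_iso_sym/X_N; rewrite muln_gt0 k0.
Qed.

(** The factor 2 is the ratio of the support radius 2/3 to the plateau radius 1/3, in units of the
    period. *)
Lemma bumped_subset m k l k' l' b b' : (0 < m)%N -> (0 < k)%N -> (0 < l)%N ->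
  (2 * k <= k')%N -> (2 * l <= l')%N ->
  bumped k l (Z k (fun=> 1) l (twist m k b)) `<=`
  (bumped k' l' (Z k' (fun=> 1) l' (twist m k' b')) : set (fun2 R)).
Proof.
move=> m0 k0 l0 kk ll _ [f [cf _ _] <-].
have k'0 : (0 < k')%N by apply: leq_trans kk; rewrite muln_gt0.
have l'0 : (0 < l')%N by apply: leq_trans ll; rewrite muln_gt0.
apply: (bumped_support (xi := f * sigma k l) k'0 l'0 (multiplier_twist R b' m0 k'0)
  (continuousM2 cf (@continuous_sigma R k l))).
move=> s t; rewrite fun2ME mulf_eq0 negb_or => /andP[_].
move=> /(sigma_neq0_lt k0 l0); rewrite pt0 pt1.
have : (2 * k)%:R <= k'%:R :> R by rewrite ler_nat.
have : (2 * l)%:R <= l'%:R :> R by rewrite ler_nat.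
by rewrite !natrM => ? ? [? ?]; split; lra.
Qed.

Lemma Cc_subset_Xi : Cc (R := R) `<=` Xi (R := R).
Proof.
move=> xi Cxi eps eps0; exists xi => //; rewrite subrr.
apply: le_lt_trans (_ : (_ <= 0)%E) _; last by rewrite lte_fin.
apply: ub_ereal_sup => _ [t _ <-].
by rewrite esum1 ?sqrte0 // => p _; rewrite Normc.normc0 expr0n.
Qed.

Lemma Cc_pull (J J' : 'M[int]_2) xi : J' *m J = 1%:M -> Cc xi -> Cc (pull J xi).
Proof.
move=> J'J /CcP[cxi [B HB]]; apply/CcP; split; first exact: continuous_pull.
pose C i : R := `|(J' i 0)%:~R| * `|B| + `|(J' i 1)%:~R| * `|B|.
exists (C 0 + C 1) => x /HB; set y := map_mx intr J *m x => -[h0 h1].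
have hB := ler_norm B.
have xy : x = map_mx intr J' *m y.
  by rewrite /y mulmxA -map_mxM J'J map_mx1 mul1mx.
clearbody y; have C0 i : 0 <= C i by rewrite addr_ge0 ?mulr_ge0.
have xC i : `|x i 0| <= C i.
  rewrite xy mulmx2E !mxE (le_trans (ler_normD _ _)) // !normrM.
  by apply: lerD; rewrite ler_wpM2l // (le_trans _ hB).
by have := (xC 0, xC 1); have := (C0 0, C0 1); case=> ? ? [? ?]; split; lra.
Qed.

Lemma orth_compl_pull (J J' : 'M[int]_2) V0 V1 :
  J *m J' = 1%:M -> J' *m J = 1%:M -> V0 `<=` Cc (R := R) ->
  orth_compl (pull J @` V1) (pull J @` V0) = pull J @` orth_compl V1 V0.
Proof.
move=> JJ' J'J V0C; apply/seteqP; split=> [_ [[xi V1xi <-] orth]|].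
  exists xi => //; split=> // eta V0eta.
  have := orth (pull J eta) (imageP _ V0eta); move=> E.
  apply: (can_inj (pullK JJ')); rewrite -[RHS]E; apply/funext => x.
  by rewrite (inner_pull _ _ JJ' J'J) //; exact: V0C.
move=> _ [xi [V1xi orth] <-]; split; first by exists xi.
move=> _ [eta V0eta <-]; apply/funext => x.
by rewrite (inner_pull _ _ JJ' J'J) ?orth //; exact: V0C.
Qed.

Lemma ladder_pull (J : 'M[int]_2) (M A : 'M[R]_2) V i :
  (forall xi, Dprime M (pull J xi) = pull J (Dprime A xi)) ->
  ladder M (pull J @` V) i = pull J @` ladder A V i.
Proof.
move=> DP; elim: i => [//|i IHi].
rewrite /ladder !iterS -/(ladder _ _ i) -/(ladder _ _ i) IHi.
by apply/seteqP; split=> [_ [_ [xi Vxi <-] <-]|_ [_ [xi Vxi <-] <-]];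
  [exists (Dprime A xi); [exists xi|]|exists (pull J xi); [exists xi|]].
Qed.

(** [(invmx S)^T] intertwines the transposes of [M] and [A], and conjugate matrices share the
    normalizing determinant. *)
Lemma Dprime_conj (S A M : 'M[int]_2) xi : S \in unitmx -> \det A != 0 ->
  M = invmx S *m A *m S ->
  Dprime (map_mx intr M) (pull (invmx S)^T xi) =
  pull (invmx S)^T (Dprime (map_mx intr A) xi).
Proof.
move=> uS A0 hM; apply/funext => x; rewrite /Dprime /pull.
have detM : \det M = \det A.
  rewrite hM !det_mulmx mulrAC -det_mulmx mulVmx // det1 mul1r //.
have uA : (map_mx intr A : 'M[R]_2)^T \in unitmx.
  by rewrite unitmx_tr unitmxE det_map_mx unitfE intr_eq0.
have uM : (map_mx intr M : 'M[R]_2)^T \in unitmx.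
  by rewrite unitmx_tr unitmxE det_map_mx unitfE intr_eq0 detM.
rewrite !det_map_mx detM; congr (_ * xi _).
set J : 'M[R]_2 := map_mx intr _.
have AJ : (map_mx intr A)^T *m J = J *m (map_mx intr M)^T.
  rewrite /J !map_trmx -!map_mxM; congr map_mx.
  by rewrite -!trmx_mul hM -!mulmxA mulmxV // mulmx1.
rewrite !mulmxA; congr (_ *m x).
apply: (can_inj (mulKmx uA)); rewrite mulKVmx // mulmxA AJ.
by rewrite -mulmxA mulmxV // mulmx1.
Qed.

End Assembly.

Theorem proposition4p1 (R : realType) (q : nat) (hq : (0 < q)%N) (a : int)
    (S : 'M[int]_2) (hS : \det S = 1)
    (d1 d2 : int) (hd1 : 1 < `|d1|) (hd2 : 1 < `|d2|)
    (A : 'M[int]_2) (hA : A = diag_mx (\row_i (if i == 0 then d1 else d2)))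
    (M : 'M[int]_2) (hM : M = invmx S *m A *m S) :
  exists V0 : set (fun2 R),
    let V := ladder (map_mx intr M) V0 in
    [/\ [/\ V0 `<=` Xi (R := R), submodule V0, fg_projective V0 &
            module_iso V0 (X q a)],
        forall i, V i `<=` V i.+1,
        Xi_closure (\bigcup_i V i) = Xi (R := R),
        forall i, module_iso (V i) (X (`|\det M| ^ i * q)%N (sgz (\det M) ^+ i * a)) &
        module_iso (orth_compl (V 1%N) V0)
          (X ((`|\det M| - 1) * q)%N ((sgz (\det M) - 1) * a))].
Proof.
have uS : S \in unitmx by rewrite unitmxE hS unitr1.
pose J := (invmx S)^T; pose J' := S^T.
have JJ' : J *m J' = 1%:M by rewrite -trmx_mul mulmxV // trmx1.
have J'J : J' *m J = 1%:M by rewrite -trmx_mul mulVmx // trmx1.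
have detJ : \det J = 1 by rewrite det_tr det_inv hS invr1.
have d10 : d1 != 0 by apply: contraTneq hd1 => ->.
have d20 : d2 != 0 by apply: contraTneq hd2 => ->.
have AE : A = diag2 d1 d2 by [].
have detA : \det A = d1 * d2 by rewrite AE det_diag2.
have detM : \det M = d1 * d2.
  by rewrite hM !det_mulmx mulrAC -det_mulmx mulVmx // det1 mul1r.
have [d D1] : exists d, `|d1|%N = d.+2 by exists `|d1|.-2%N; lia.
have [d' D2] : exists d', `|d2|%N = d'.+2 by exists `|d2|.-2%N; lia.
(* The parameter [d.+2] is [|d1|], as the computation of the complement requires. *)
pose V0 : set (fun2 R) := bumped 1 q (Z 1 (fun=> 1) q (twist d.+2 1 a)).
pose V i : set (fun2 R) := bumped (`|d1| ^ i) (`|d2| ^ i * q)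
    (Z (`|d1| ^ i) (fun=> 1) (`|d2| ^ i * q)
       (twist d.+2 (`|d1| ^ i) (sgz (d1 * d2) ^+ i * a))).
have K0 i : (0 < `|d1| ^ i)%N by rewrite expn_gt0 D1.
have L0 i : (0 < `|d2| ^ i * q)%N by rewrite muln_gt0 expn_gt0 D2.
have VE i : ladder (map_mx intr M) (pull J @` V0) i = pull J @` V i.
  rewrite (ladder_pull _ _ (fun xi => Dprime_conj xi uS _ hM)) ?AE; last first.
    by rewrite -AE detA mulf_neq0.
  by rewrite ladder_diag2.
have V0E : V 0%N = V0 by rewrite /V !expn0 mul1n mul1r.
have VC i : V i `<=` Cc (R := R).
  exact: (bumped_Cc (K0 i) (L0 i) (@subset_refl _ _)).
have VX i : module_iso (pull J @` V i)
    (X (`|\det M| ^ i * q)%N (sgz (\det M) ^+ i * a)).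
  rewrite detM abszM expnMn -mulnA.
  have KL0 : (0 < `|d1| ^ i * (`|d2| ^ i * q))%N by rewrite muln_gt0 K0 L0.
  apply: module_iso_trans (X_pull _ _ detJ JJ' J'J KL0).
  by apply: (module_iso_pull JJ' J'J); exact: bumped_X.
have iso0 : module_iso (pull J @` V0) (X q a).
  by have := VX 0%N; rewrite V0E expn0 mul1n mul1r.
exists (pull J @` V0); split.
- split.
  + move=> _ [xi Vxi <-]; apply/Cc_subset_Xi/(Cc_pull J'J)/(VC 0%N).
    by rewrite V0E.
  + by have [] := iso0.
  + exact: (X_fg_projective hq iso0).
  + exact: iso0.
- move=> i; rewrite !VE; apply: image_subset; apply: bumped_subset => //.
    by rewrite expnS leq_mul2r D1 orbT.
  by rewrite expnS -mulnA leq_mul2r D2 orbT.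
- rewrite /Xi; congr Xi_closure; apply/seteqP; split.
    by move=> xi [i _]; rewrite VE => -[eta /VC Ceta <-]; exact: (Cc_pull J'J).
  move=> xi /(Cc_pull JJ') Cxi.
  have [cxi [B HB]] := (CcP _).1 Cxi.
  (* Since [i < m ^ i] for [m > 1], the plateau at level [i] has radius at least [i / 3], hence at
     least [|B|], in both directions. *)
  pose i := (Num.truncn (3 * `|B|)).+1.
  have iB : `|B| <= 3^-1 * i%:R.
    by have := truncnS_gt (3 * `|B|); rewrite -/i; lra.
  have iK m : (1 < m)%N -> `|B| <= 3^-1 * (m ^ i)%:R.
    move=> m1; apply: (le_trans iB); rewrite ler_wpM2l ?invr_ge0 //.
    by rewrite ler_nat ltnW // ltn_expl.
  exists i => //; rewrite VE; exists (pull J' xi); last exact: (pullK J'J).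
  apply: (bumped_support (K0 i) (L0 i)
    (multiplier_twist R _ (ltn0Sn d.+1) (K0 i)) cxi).
  move=> s t /HB; rewrite pt0 pt1 => -[h0 h1].
  have hB := ler_norm B.
  split; [apply: (le_trans (le_trans h0 hB)); apply: iK; by rewrite D1|].
  apply: (le_trans (le_trans h1 hB)); apply: (le_trans (iK `|d2|%N _)).
    by rewrite D2.
  by rewrite ler_wpM2l ?invr_ge0 // ler_nat leq_pmulr.
- by move=> i; rewrite VE; exact: VX.
- rewrite VE (orth_compl_pull _ JJ' J'J); last by rewrite -V0E; exact: VC.
  rewrite detM abszM D1 D2.
  have n0 : (0 < (d.+2 * d'.+2 - 1) * q)%N by rewrite muln_gt0 hq andbT; lia.
  apply: module_iso_trans (X_pull _ _ detJ JJ' J'J n0).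
  apply: (module_iso_pull JJ' J'J).
  rewrite /V D1 D2 !expn1 expr1 orth_compl_bumped //.
  have isoK := @kernel_iso R q d d' a (sgz (d1 * d2)) hq.
  have [sK _ _] := isoK; apply: module_iso_trans isoK.
  apply: (@sigma_iso R d.+2 (fun=> 1) (d'.+2 * q)
    (twist d.+2 d.+2 (sgz (d1 * d2) * a))) => //.
  + by rewrite muln_gt0.
  + by move=> s; exact: twist_neq0.
  + by move=> h [].
Qed.
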